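(* Let $(M,d)$ be a complete pointed metric space and let $\nu$ be a positive Radon measure on $\beta\widetilde{M}$ with $\|\nu\|=\|\Phi^*\nu\|$. Then there exists a positive Radon measure $\mu$ on $\beta\widetilde{M}$ with $\|\mu\|=\|\Phi^*\mu\|$ such that: (i) $\Phi^*\mu=\Phi^*\nu$; (ii) if $\nu$ is concentrated on a set belonging to $\mathfrak{C}$, then so is $\mu$; (iii) if $\nu$ is concentrated on $\mathcal{R}\setminus\Delta(A)$ for a Borel set $A\subset\mathcal{R}(M)$, then $((p_1)_\sharp\mu)|_A\perp((p_2)_\sharp\mu)|_A$.
   Context: $\mathrm{Lip}_0(M)$: Lipschitz $f:M\to\mathbb{R}$ with $f(0)=0$ ($0$ the base point), normed by the Lipschitz constant. $\widetilde{M}=\{(x,y)\in M\times M:x\ne y\}$, $\beta\widetilde{M}$ its Stone–Čech compactification, Radon measures identified with $C(\beta\widetilde{M})^*$. $\Phi:\mathrm{Lip}_0(M)\to C(\beta\widetilde{M})$ maps $f$ to the continuous extension of $(x,y)\mapsto(f(x)-f(y))/d(x,y)$; $\Phi^*$ its adjoint. $d:\beta\widetilde{M}\to[0,\infty]$ is the continuous extension of the metric on $\widetilde{M}$. $M^u$ is the uniform (Samuel) compactification of $M$; $p_1,p_2:\beta\widetilde{M}\to M^u$ continuously extend the coordinate projections, $p=(p_1,p_2)$. $\mathcal{R}(M)=\{\xi\in M^u:\overline{d_0}(\xi)<\infty\}$ where $\overline{d_0}$ is the continuous extension of $x\mapsto d(x,0)$ to $M^u\to[0,\infty]$; $\mathcal{R}=p^{-1}(\mathcal{R}(M)\times\mathcal{R}(M))$.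 For Borel $A\subset\mathcal{R}(M)$, $\Delta(A)=d^{-1}(0)\cap p^{-1}(A\times A)$. $G$ is the set of $g\in C(\beta\widetilde{M})$ with $d(x,y)g(x,y)\le d(x,u)g(x,u)+d(u,y)g(u,y)$ for all distinct $x,u,y\in M$; for positive Radon measures, $\mu\preccurlyeq\nu$ iff $\int g\,d\mu\le\int g\,d\nu$ for all $g\in G$. $\mathfrak{C}$ is the family of Borel sets $C\subset\beta\widetilde{M}$ such that whenever $\mu,\nu$ are positive Radon measures, $\nu$ is concentrated on $C$ and $\mu\preccurlyeq\nu$, then $\mu$ is concentrated on $C$. Throughout, $M$ has at least three distinct points. *)

(* Defs.v *)
From HB Require Import structures.
From mathcomp Require Import all_boot all_order all_algebra.
From mathcomp Require Import all_classical all_reals all_analysis.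
Set Implicit Arguments. Unset Strict Implicit. Unset Printing Implicit Defensive.
Import Order.TTheory GRing.Theory Num.Theory.
Import numFieldNormedType.Exports.
Local Open Scope classical_set_scope.
Local Open Scope ring_scope.

Definition is_metric (R : realType) (M : Type) (d : M -> M -> R) : Prop :=
  (forall x y, 0 <= d x y) /\ (forall x y, d x y = 0 <-> x = y) /\
  (forall x y, d x y = d y x) /\ (forall x y z, d x z <= d x y + d y z).

Definition cauchy_seq (R : realType) (M : Type) (d : M -> M -> R) (u : nat -> M) :=
  forall e : R, 0 < e -> exists N, forall m n, (N <= m)%N -> (N <= n)%N -> d (u m) (u n) < e.

Definition complete_metric (R : realType) (M : Type) (d : M -> M -> R) : Prop :=
  forall u : nat -> M, cauchy_seq d u ->
    exists l, forall e : R, 0 < e -> exists N, forall n, (N <= n)%N -> d (u n) l < e.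

Definition Mt (M : Type) := {p : M * M | p.1 <> p.2}.
Definition fstMt (M : Type) (p : Mt M) : M := (sval p).1.
Definition sndMt (M : Type) (p : Mt M) : M := (sval p).2.

Definition mt_continuous (R : realType) (M : Type) (d : M -> M -> R) (T : topologicalType)
  (g : Mt M -> T) : Prop :=
  forall p : Mt M, forall U, nbhs (g p) U -> exists2 e : R, 0 < e &
    forall q : Mt M, d (fstMt p) (fstMt q) + d (sndMt p) (sndMt q) < e -> U (g q).

Definition m_continuous (R : realType) (M : Type) (d : M -> M -> R) (T : topologicalType)
  (g : M -> T) : Prop :=
  forall x : M, forall U, nbhs (g x) U -> exists2 e : R, 0 < e &
    forall y : M, d x y < e -> U (g y).

Definition bounded_fun (R : realType) (X : Type) (f : X -> R) : Prop :=
  exists B : R, forall x, `|f x| <= B.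

Definition unif_continuous (R : realType) (M : Type) (d : M -> M -> R) (f : M -> R) : Prop :=
  forall e : R, 0 < e -> exists2 delta : R, 0 < delta &
    forall x y, d x y < delta -> `|f x - f y| < e.

Definition is_stone_cech (R : realType) (M : Type) (d : M -> M -> R) (K : ptopologicalType)
  (iota : Mt M -> K) : Prop :=
  [/\ compact [set: K], hausdorff_space K, mt_continuous d iota,
      closure (range iota) = [set: K] &
      forall f : Mt M -> R, bounded_fun f -> mt_continuous d f ->
        exists F : K -> R, continuous F /\ forall p, F (iota p) = f p].

Definition is_samuel (R : realType) (M : Type) (d : M -> M -> R) (Ku : ptopologicalType)
  (iu : M -> Ku) : Prop :=
  [/\ compact [set: Ku], hausdorff_space Ku, m_continuous d iu,
      closure (range iu) = [set: Ku] &
      ((forall f : M -> R, bounded_fun f -> unif_continuous d f ->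
        exists F : Ku -> R, continuous F /\ forall x, F (iu x) = f x) /\
      (forall F : Ku -> R, continuous F -> unif_continuous d (F \o iu)))].

Notation Borel K := (g_sigma_algebraType (@open K)).

Definition radon (R : realType) (K : ptopologicalType)
  (mu : {measure set (Borel K) -> \bar R}) : Prop :=
  (mu setT < +oo)%E /\
  forall B : set (Borel K), measurable B -> forall e : R, 0 < e ->
    exists C : set K, [/\ @compact K C, C `<=` B & (mu B <= mu C + e%:E)%E].

Definition concentrated (R : realType) (K : ptopologicalType)
  (mu : {measure set (Borel K) -> \bar R}) (C : set K) : Prop :=
  mu (~` C) = 0%E.

Definition lip0_ball (R : realType) (M : Type) (d : M -> M -> R) (o : M) (f : M -> R) :=
  f o = 0 /\ forall x y, `|f x - f y| <= d x y.

Definition lip0 (R : realType) (M : Type) (d : M -> M -> R) (o : M) (f : M -> R) :=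
  f o = 0 /\ exists L : R, forall x y, `|f x - f y| <= L * d x y.

Definition is_Phi (R : realType) (M : Type) (d : M -> M -> R) (K : ptopologicalType)
  (iota : Mt M -> K) (f : M -> R) (F : K -> R) : Prop :=
  continuous F /\
  forall p : Mt M, F (iota p) = (f (fstMt p) - f (sndMt p)) / d (fstMt p) (sndMt p).

(* <Phi^* mu, f> = \int Phi f d mu *)
Definition PhiStar_eq (R : realType) (M : Type) (d : M -> M -> R) (o : M) (K : ptopologicalType)
  (iota : Mt M -> K) (mu nu : {measure set (Borel K) -> \bar R}) : Prop :=
  forall f F, lip0 d o f -> is_Phi d iota f F ->
    (\int[mu]_x (F x)%:E = \int[nu]_x (F x)%:E)%E.

Definition PhiStar_norm (R : realType) (M : Type) (d : M -> M -> R) (o : M) (K : ptopologicalType)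
  (iota : Mt M -> K) (mu : {measure set (Borel K) -> \bar R}) : \bar R :=
  ereal_sup [set r | exists f F, [/\ lip0_ball d o f, is_Phi d iota f F &
                                      r = `| \int[mu]_x (F x)%:E |%E]].

Definition in_G (R : realType) (M : Type) (d : M -> M -> R) (K : ptopologicalType)
  (iota : Mt M -> K) (g : K -> R) : Prop :=
  continuous g /\
  forall (x u y : M) (hxu : x <> u) (huy : u <> y) (hxy : x <> y),
    d x y * g (iota (exist _ (x, y) hxy)) <=
      d x u * g (iota (exist _ (x, u) hxu)) + d u y * g (iota (exist _ (u, y) huy)).

Definition prec (R : realType) (M : Type) (d : M -> M -> R) (K : ptopologicalType)
  (iota : Mt M -> K) (mu nu : {measure set (Borel K) -> \bar R}) : Prop :=
  forall g, in_G d iota g -> (\int[mu]_x (g x)%:E <= \int[nu]_x (g x)%:E)%E.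

Definition frakC (R : realType) (M : Type) (d : M -> M -> R) (K : ptopologicalType)
  (iota : Mt M -> K) (C : set (Borel K)) : Prop :=
  measurable C /\
  forall mu nu : {measure set (Borel K) -> \bar R}, radon mu -> radon nu ->
    concentrated nu C -> prec d iota mu nu -> concentrated mu C.

Definition RM (R : realType) (Ku : ptopologicalType) (d0bar : Ku -> \bar R) : set Ku :=
  [set xi | (d0bar xi < +oo)%E].

Definition calR (R : realType) (K Ku : ptopologicalType) (d0bar : Ku -> \bar R)
  (p1 p2 : K -> Ku) : set K :=
  [set k | RM d0bar (p1 k) /\ RM d0bar (p2 k)].

Definition Delta (R : realType) (K Ku : ptopologicalType) (dbar : K -> \bar R)
  (p1 p2 : K -> Ku) (A : set Ku) : set K :=
  [set k | dbar k = 0%E /\ A (p1 k) /\ A (p2 k)].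

Definition restr_push_singular (R : realType) (K Ku : ptopologicalType)
  (mu : {measure set (Borel K) -> \bar R}) (p1 p2 : K -> Ku) (A : set Ku) : Prop :=
  exists B : set (Borel Ku), measurable B /\
    mu (p1 @^-1` (A `&` B)) = 0%E /\ mu (p2 @^-1` (A `&` ~` B)) = 0%E.

(* Main.v *)
Require Import Defs.
From HB Require Import structures.
From mathcomp Require Import all_boot all_order all_algebra.
From mathcomp Require Import all_classical all_reals all_analysis.
From mathcomp Require Import measurable_realfun ring lra.
Import Order.TTheory GRing.Theory Num.Theory.
Import numFieldNormedType.Exports.
Local Open Scope classical_set_scope.
Local Open Scope ring_scope.

(** Let [phi] be the continuous extension of [1 / (1 + d)]. Among the positive measures [mu] with
[prec mu nu] choose one minimizing the integral of [phi]: it exists by the Hahn-Banach theorem,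
applied to the sublinear functional [h |-> inf {\int g dnu | g in G, g >= h}], followed by the
Riesz-Markov theorem. Duality gives [g_n] in G with [g_n >= - phi] and [\int (g_n + phi) dmu -> 0],
hence a sigma-compact set [F] of full measure in [{0 < d < oo}] on which [g_n -> - phi].

If [k1], [k2] in [F] satisfy [p2 k1 = p1 k2], with [a = d k1] and [b = d k2], then [k1] and [k2] are
limits of pairs [(x, u)] and [(v, y)] with [d u v -> 0], so the inequality defining G gives
[a * g_n k1 + b * g_n k2 >= - w (a + b)] for [w t = t / (1 + t)]. In the limit
[w a + w b <= w (a + b)], which contradicts the strict subadditivity of [w]. Thus [p1 F] and [p2 F]
are disjoint, and [p2 F] separates the two marginals on [A].

The part of [mu] outside [{0 < d < oo}] is controlled by testing [prec mu nu] on the functions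
[min 1 ((w x + w y) / d x y)] of G, for 1-Lipschitz [w >= 0]. *)

Set Implicit Arguments.
Unset Strict Implicit.
Unset Printing Implicit Defensive.

(** * The Hahn-Banach theorem *)

(** The choice of [phi] is dictated by the weight [d] in the definition of G: [d * phi] is [w] of
    the distance, so replacing two pairs that meet at a junction by a single pair strictly lowers
    the integral, while [phi] stays bounded and extends to [K]. The gain degenerates when a distance
    is [0] or infinite. Hypothesis (iii) keeps [nu] off these regions over [A], but null sets do not
    pass down [prec] by themselves: each needs a function of G that is small on a compact set
    carrying most of [nu] and at least 1/2 on the null set. Supporting the sublinear functional at
    [- phi] gives the measure and the duality at once, its value there being the infimum over the
    functions of G above [- phi]. Sigma-compactness of [F] makes [p2 F] a Borel set. Part (i) holds
    because G contains [Phi f] with both signs; part (ii) is the definition of the family. *)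

Lemma inf_leD (R : realType) (A B C : set R) : A !=set0 -> B !=set0 ->
  has_lbound C -> (forall a b, A a -> B b -> exists2 c, C c & c <= a + b) ->
  inf C <= inf A + inf B.
Proof.
move=> A0 B0 lC H.
have HB a : A a -> inf C - a <= inf B.
  move=> Aa; apply: lb_le_inf => // b Bb; have [c Cc cab] := H _ _ Aa Bb.
  by rewrite lerBlDl (le_trans (ge_inf lC Cc)).
rewrite -lerBlDr; apply: lb_le_inf => // a Aa.
by rewrite lerBlDr -lerBlDl HB.
Qed.

Lemma inf_leM (R : realType) (A C : set R) (t : R) : 0 < t -> A !=set0 ->
  has_lbound C -> (forall a, A a -> exists2 c, C c & c <= t * a) ->
  inf C <= t * inf A.
Proof.
move=> t0 A0 lC H; rewrite -ler_pdivrMl//.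
apply: lb_le_inf => // a Aa; have [c Cc ca] := H _ Aa.
by rewrite ler_pdivrMl// (le_trans (ge_inf lC Cc)).
Qed.

Section HahnBanach.
Context (R : realType) (V : lmodType R).

(** Everything is relative to [S] because the application is to the continuous functions inside the
    module of all functions [K -> R^o]. *)
Definition subspace_on (S : set V) : Prop :=
  [/\ S 0, forall x y, S x -> S y -> S (x + y) & forall (a : R) x, S x -> S (a *: x)].

(** The inequality for [t > 0] passes directly to infima; equality and [p 0 = 0] follow by scaling
    back. *)
Definition sublinear_on (S : set V) (p : V -> R) : Prop :=
  (forall (t : R) x, S x -> 0 < t -> p (t *: x) <= t * p x) /\
  (forall x y, S x -> S y -> p (x + y) <= p x + p y).

Definition linear_on (S : set V) (m : V -> R) : Prop :=
  (forall x y, S x -> S y -> m (x + y) = m x + m y) /\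
  (forall (a : R) x, S x -> m (a *: x) = a * m x).

Variable S : set V.
Hypothesis subS : subspace_on S.

Let S0 : S 0. Proof. by case: subS. Qed.
Let SD x y : S x -> S y -> S (x + y). Proof. by case: subS => _ + _; exact. Qed.
Let SZ (a : R) x : S x -> S (a *: x). Proof. by case: subS => _ _; exact. Qed.
Let SN x : S x -> S (- x). Proof. by move=> Sx; rewrite -scaleN1r; exact: SZ. Qed.

Lemma sublinear0 p : sublinear_on S p -> p 0 = 0.
Proof.
move=> [pZ _]; have h2 := pZ 2 0 S0 ltac:(by []).
have h3 : p (2^-1 *: 0) <= 2^-1 * p 0 by apply: pZ => //; rewrite invr_gt0.
move: h2 h3; rewrite !scaler0; lra.
Qed.

Lemma sublinear_ge_opp p x : sublinear_on S p -> S x -> - p (- x) <= p x.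
Proof.
move=> sp Sx; have [_ pD] := sp; have := pD _ _ Sx (SN Sx).
by rewrite subrr sublinear0//; lra.
Qed.

Lemma sublinearZ p t x : sublinear_on S p -> S x -> 0 < t -> p (t *: x) = t * p x.
Proof.
move=> [pZ _] Sx t0; apply/eqP; rewrite eq_le pZ//=.
have := pZ t^-1 _ (SZ t Sx); rewrite invr_gt0 => /(_ t0).
by rewrite scalerA mulVf ?gt_eqF// scale1r ler_pdivlMl.
Qed.

(* The largest sublinear functional below [p] that is at most [- p y] at [- y]. *)
Definition flatten_along (p : V -> R) (y x : V) : R :=
  inf [set r | exists2 t, 0 <= t & r = p (x + t *: y) - t * p y].

Lemma flatten_lbound p x y : sublinear_on S p -> S x -> S y ->
  lbound [set r | exists2 t, 0 <= t & r = p (x + t *: y) - t * p y] (- p (- x)).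
Proof.
move=> sp Sx Sy _ [t t0 ->].
have [-> | tN0] := eqVneq t 0.
  by rewrite scale0r mul0r addr0 subr0 sublinear_ge_opp.
have tp : 0 < t by rewrite lt_neqAle eq_sym tN0.
have [_ pD] := sp.
have := pD _ _ (SD Sx (SZ t Sy)) (SN Sx).
by rewrite addrAC subrr add0r (sublinearZ sp Sy tp); lra.
Qed.

Lemma flatten_has_lbound p x y : sublinear_on S p -> S x -> S y ->
  has_lbound [set r | exists2 t, 0 <= t & r = p (x + t *: y) - t * p y].
Proof. by move=> sp Sx Sy; exists (- p (- x)); exact: flatten_lbound. Qed.

Lemma flatten_le p x y t : sublinear_on S p -> S x -> S y -> 0 <= t ->
  flatten_along p y x <= p (x + t *: y) - t * p y.
Proof. by move=> sp Sx Sy t0; apply: ge_inf; [exact: flatten_has_lbound | exists t]. Qed.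

Lemma flatten_sublinear p y : sublinear_on S p -> S y -> sublinear_on S (flatten_along p y).
Proof.
move=> sp Sy; split=> [t x Sx t0 | x x' Sx Sx'].
- apply: inf_leM => //.
  + by exists (p (x + 0 *: y) - 0 * p y); exists 0.
  + by apply: flatten_has_lbound => //; exact: SZ.
  + move=> _ [s s0 ->]; exists (p (t *: x + (t * s) *: y) - (t * s) * p y).
      by exists (t * s) => //; rewrite mulr_ge0// ltW.
    rewrite -scalerA -scalerDr (sublinearZ sp _ t0); last exact: SD Sx (SZ _ Sy).
    by rewrite mulrBr mulrA.
- apply: inf_leD.
  + by exists (p (x + 0 *: y) - 0 * p y); exists 0.
  + by exists (p (x' + 0 *: y) - 0 * p y); exists 0.
  + by apply: flatten_has_lbound => //; exact: SD.
  + move=> _ _ [s s0 ->] [t t0 ->].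
    exists (p (x + x' + (s + t) *: y) - (s + t) * p y).
      by exists (s + t) => //; exact: addr_ge0.
    rewrite scalerDl addrACA.
    have [_ pD] := sp.
    have := pD _ _ (SD Sx (SZ s Sy)) (SD Sx' (SZ t Sy)); lra.
Qed.

Lemma flatten_along_le p x y : sublinear_on S p -> S x -> S y -> flatten_along p y x <= p x.
Proof.
by move=> sp Sx Sy; have := flatten_le sp Sx Sy (lexx 0); rewrite scale0r mul0r addr0 subr0.
Qed.

Lemma flatten_along_opp p y : sublinear_on S p -> S y -> flatten_along p y (- y) <= - p y.
Proof.
move=> sp Sy; have := flatten_le sp (SN Sy) Sy ler01.
by rewrite scale1r mul1r addNr sublinear0// sub0r.
Qed.

(* A sublinear functional that is minimal below [q] is linear, since flattening it does not change it. *)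
Lemma minimal_sublinear_linear p : sublinear_on S p ->
  (forall p', sublinear_on S p' -> (forall x, S x -> p' x <= p x) ->
     forall x, S x -> p x <= p' x) -> linear_on S p.
Proof.
move=> sp min.
have pN y : S y -> p (- y) = - p y.
  move=> Sy; apply/eqP; rewrite eq_le; apply/andP; split.
    apply: le_trans (flatten_along_opp sp Sy).
    apply: min => //; [exact: flatten_sublinear| |exact: SN].
    by move=> x Sx; exact: flatten_along_le.
  by have := sublinear_ge_opp sp Sy; lra.
have [_ pD] := sp.
split=> [x y Sx Sy | a x Sx].
  apply/eqP; rewrite eq_le pD//=.
  have := pD _ _ (SN Sx) (SN Sy).
  by rewrite -opprD !pN//; [lra | exact: SD].
have [a0|a0|->] := ltgtP a 0.
- have Na : 0 < - a by rewrite oppr_gt0.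
  have := pN _ (SZ (- a) Sx); rewrite -scaleNr opprK (sublinearZ sp Sx Na) => ->.
  by rewrite mulNr opprK.
- exact: sublinearZ.
- by rewrite scale0r mul0r sublinear0.
Qed.

(** Zorn's lemma for the reversed pointwise order; [Rel] is only a preorder because values off [S]
    are unconstrained. A chain is bounded by its pointwise infimum, kept finite by [- q (- x)]. *)
Lemma exists_minimal_sublinear q : sublinear_on S q ->
  exists p, [/\ sublinear_on S p, forall x, S x -> p x <= q x &
    forall p', sublinear_on S p' -> (forall x, S x -> p' x <= p x) ->
     forall x, S x -> p x <= p' x].
Proof.
move=> sq.
pose T := {p : V -> R | sublinear_on S p /\ (forall x, S x -> p x <= q x)}.
pose Rel (s t : T) := `[< forall x, S x -> sval t x <= sval s x >].
have qT : sublinear_on S q /\ (forall x, S x -> q x <= q x) by [].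
have [|||[p [sp pq]] pmin] := @ZL_preorder T (exist _ q qT) Rel.
- by move=> t; apply/asboolP.
- move=> r s t /asboolP rs /asboolP st; apply/asboolP => x Sx.
  by rewrite (le_trans (st _ Sx))// rs.
- move=> C totC.
  have [[c0 Cc0]|Cempty] := pselect (exists c, C c); last first.
    by exists (exist _ q qT) => s Cs; exfalso; apply: Cempty; exists s.
  pose vals x := [set r | exists2 c : T, C c & r = sval c x].
  have vals0 x : vals x !=set0 by exists (sval c0 x); exists c0.
  have lbv x : S x -> has_lbound (vals x).
    move=> Sx; exists (- q (- x)) => _ [[c [sc cq]] _ ->] /=.
    apply: le_trans (sublinear_ge_opp sc Sx).
    by rewrite lerN2 cq//; exact: SN.
  have infT : sublinear_on S (fun x => inf (vals x)) /\
      (forall x, S x -> inf (vals x) <= q x).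
    split; first split=> [t x Sx t0 | x y Sx Sy].
    + apply: inf_leM => //; first exact/lbv/SZ.
      move=> _ [c Cc ->]; exists (sval c (t *: x)); first by exists c.
      by case: c {Cc} => c [[sc _] ?] /=; exact: sc.
    + apply: inf_leD => //; first exact/lbv/SD.
      move=> _ _ [c Cc ->] [c' Cc' ->].
      (* Subadditivity of the infimum uses the chain: the smaller of [c] and [c'] serves at both [x]
         and [y]. *)
      have [/asboolP cc'|/asboolP cc'] := totC _ _ Cc Cc'.
        exists (sval c' (x + y)); first by exists c'.
        apply: (@le_trans _ _ (sval c' x + sval c' y)); last first.
          by rewrite lerD2r cc'.
        by case: c' {Cc' cc'} => c' [[_ sc] ?] /=; exact: sc.
      exists (sval c (x + y)); first by exists c.
      apply: (@le_trans _ _ (sval c x + sval c y)); last first.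
        by rewrite lerD2l cc'.
      by case: c {Cc cc'} => c [[_ sc] ?] /=; exact: sc.
    + move=> x Sx; apply: (@le_trans _ _ (sval c0 x)).
        by apply: ge_inf; [exact: lbv | exists c0].
      by case: c0 {Cc0 vals0} => c [? cq] /=; exact: cq.
  exists (exist _ (fun x => inf (vals x)) infT : T) => s Cs; apply/asboolP => x Sx /=.
  by apply: ge_inf; [exact: lbv | exists s].
exists p; split=> // p' sp' p'p.
have p'T : sublinear_on S p' /\ (forall x, S x -> p' x <= q x).
  by split=> // x Sx; rewrite (le_trans (p'p _ Sx))// pq.
have := pmin (exist _ p' p'T : T); rewrite /Rel /= => H.
by have /asboolP := H ltac:(exact/asboolP).
Qed.

(** Flattening along [y] before minimizing fixes the value at [y]: whatever lies below the flattened
    functional is at most [- q y] at [- y], and linearity turns this into [q y <= m y]. *)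
Theorem hahn_banach_support q y : sublinear_on S q -> S y ->
  exists m, [/\ linear_on S m, forall x, S x -> m x <= q x & m y = q y].
Proof.
move=> sq Sy.
have [m [sm mq mmin]] := exists_minimal_sublinear (flatten_sublinear sq Sy).
have linm := minimal_sublinear_linear sm mmin.
have mq' x : S x -> m x <= q x.
  by move=> Sx; rewrite (le_trans (mq _ Sx))// flatten_along_le.
exists m; split=> //; apply/eqP; rewrite eq_le mq'//=.
have : m (- y) <= - q y by rewrite (le_trans (mq _ (SN Sy)))// flatten_along_opp.
by rewrite -scaleN1r linm.2// mulN1r lerN2.
Qed.

End HahnBanach.

(** * Continuous functions and Borel measures *)

Section ContinuousFunctions.
Context (R : realType) (K : topologicalType).

Lemma continuous_add (f g : K -> R) : continuous f -> continuous g -> continuous (fun x => f x + g x : R).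
Proof. by move=> cf cg x; apply: cvgD; [exact: cf | exact: cg]. Qed.

Lemma continuous_sub (f g : K -> R) : continuous f -> continuous g -> continuous (fun x => f x - g x : R).
Proof. by move=> cf cg x; apply: cvgB; [exact: cf | exact: cg]. Qed.

Lemma continuous_opp (f : K -> R) : continuous f -> continuous (fun x => - f x : R).
Proof. by move=> cf x; apply: cvgN; exact: cf. Qed.

Lemma continuous_mul (f g : K -> R) : continuous f -> continuous g -> continuous (fun x => f x * g x : R).
Proof. by move=> cf cg x; apply: cvgM; [exact: cf | exact: cg]. Qed.

Lemma continuous_const (c : R) : continuous (fun _ : K => c).
Proof. by move=> x; exact: cvg_cst. Qed.

Lemma maxr_continuous (f g : K -> R) : continuous f -> continuous g ->
  continuous (fun x => Num.max (f x) (g x) : R).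
Proof. by move=> cf cg x; apply: continuous_max; [exact: cf | exact: cg]. Qed.

Lemma minr_continuous (f g : K -> R) : continuous f -> continuous g ->
  continuous (fun x => Num.min (f x) (g x) : R).
Proof. by move=> cf cg x; apply: continuous_min; [exact: cf | exact: cg]. Qed.

Lemma open_preimage_lt (f : K -> R) (c : R) : continuous f -> open [set x | c < f x].
Proof. by move=> cf; apply: (@open_comp _ _ f [set y | c < y]); [move=> x _; exact: cf | exact: open_gt]. Qed.

Lemma open_preimage_gt (f : K -> R) (c : R) : continuous f -> open [set x | f x < c].
Proof. by move=> cf; apply: (@open_comp _ _ f [set y | y < c]); [move=> x _; exact: cf | exact: open_lt]. Qed.

Lemma closed_preimage_le (f : K -> R) (c : R) : continuous f -> closed [set x | f x <= c].
Proof. by move=> cf; apply: (@closed_comp _ _ f [set y | y <= c]); [move=> x _; exact: cf | exact: closed_le]. Qed.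

Lemma closed_preimage_ge (f : K -> R) (c : R) : continuous f -> closed [set x | c <= f x].
Proof. by move=> cf; apply: (@closed_comp _ _ f [set y | c <= y]); [move=> x _; exact: cf | exact: closed_ge]. Qed.

Lemma continuous_bounded (f : K -> R) : compact [set: K] -> continuous f ->
  exists2 B : R, 0 <= B & forall x, `|f x| <= B.
Proof.
move=> cK cf.
have cfK : compact (f @` [set: K]).
  by apply: continuous_compact => //; exact: continuous_subspaceT.
have [B [_ fB]] := compact_bounded cfK.
exists (Num.max 0 (B + 1)); first by rewrite le_max lexx.
move=> x; rewrite le_max; apply/orP; right.
by apply: (fB (B + 1)); [rewrite ltrDl | exists x].
Qed.

End ContinuousFunctions.

Lemma compact_increasing_cover (K : ptopologicalType) (C : set K) (U : nat -> set K) :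
  compact C -> (forall n, open (U n)) -> (forall m n, (m <= n)%N -> U m `<=` U n) ->
  C `<=` \bigcup_n U n -> exists n, C `<=` U n.
Proof.
rewrite compact_cover => cC oU incU CU.
have [D _ CD] := cC nat setT U (fun n _ => oU n) CU.
exists (\max_(i <- finmap.enum_fset D) i)%N => x Cx.
have [i iD Uix] := CD _ Cx.
by apply: incU Uix; exact: (@leq_bigmax_seq _ _ xpredT id i).
Qed.

Lemma urysohn_compact (R : realType) (K : ptopologicalType) (A B : set K) :
  compact [set: K] -> hausdorff_space K -> closed A -> closed B -> A `&` B = set0 ->
  exists f : K -> R, [/\ continuous f, forall x, 0 <= f x <= 1,
    forall x, A x -> f x = 0 & forall x, B x -> f x = 1].
Proof.
move=> cK hK cA cB AB.
have /(@normal_separatorP R)/(_ A B cA cB AB) : normal_space K by exact: compact_normal.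
move=> /(@uniform_separatorP K R A B)[f [cf f01 fA fB]].
exists f; split=> //.
- by move=> x; have := f01 (f x); rewrite /= in_itv /=; apply; exists x.
- by move=> x Ax; apply: fA; exists x.
- by move=> x Bx; apply: fB; exists x.
Qed.

Section BorelIntegral.
Context (R : realType) (K : ptopologicalType).

Lemma open_Borel (U : set (Borel K)) : @open K U -> measurable U.
Proof. by move=> oU; exact: sub_sigma_algebra. Qed.

Lemma closed_Borel (C : set (Borel K)) : @closed K C -> measurable C.
Proof.
by move=> cC; rewrite -(setCK C); apply: measurableC; apply: open_Borel; exact: closed_openC.
Qed.

Lemma Borel_preimage (L : ptopologicalType) (f : K -> L) (A : set (Borel L)) :
  continuous f -> measurable A -> measurable (f @^-1` A : set (Borel K)).
Proof.
move=> cf mA; rewrite -[f @^-1` A]setTI.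
apply: (@measurability _ _ (Borel K) (Borel L) setT f (@open L)) => //.
move=> _ [U oU <-]; rewrite setTI; apply: open_Borel.
by apply: open_comp => // x _; exact: cf.
Qed.

Lemma continuous_Borel (f : K -> R) : continuous f -> measurable_fun setT (f : Borel K -> R).
Proof.
move=> cf; apply: (measurability _ (RGenOInfty.measurableE R)).
move=> /= _ [_ [a ->]] <-; rewrite setTI; apply: open_Borel.
rewrite (_ : _ @^-1` _ = [set x | a < f x]); first exact: open_preimage_lt.
by apply/seteqP; split => x /=; rewrite in_itv /= andbT.
Qed.

Variable mu : {measure set (Borel K) -> \bar R}.
Hypothesis cK : compact [set: K].
Hypothesis mufin : (mu setT < +oo)%E.

Lemma continuous_integrable (f : K -> R) : continuous f -> mu.-integrable setT (EFin \o f).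
Proof.
move=> cf; apply: measurable_bounded_integrable => //; first exact: continuous_Borel.
have [B B0 fB] := continuous_bounded cK cf.
by exists B; split; [exact: num_real | move=> M BM x _ /=; exact: le_trans (fB x) (ltW BM)].
Qed.

Lemma integral_RintegralE (f : K -> R) : continuous f ->
  (\int[mu]_x (f x)%:E)%E = (\int[mu]_x f x)%:E.
Proof.
by move=> cf; rewrite /Rintegral fineK//; apply: integrable_fin_num => //; exact: continuous_integrable.
Qed.

Lemma Rintegral_add (f g : K -> R) : continuous f -> continuous g ->
  \int[mu]_x (f x + g x) = \int[mu]_x f x + \int[mu]_x g x.
Proof. by move=> cf cg; apply: RintegralD => //; exact: continuous_integrable. Qed.

Lemma Rintegral_scale (a : R) (f : K -> R) : continuous f ->
  \int[mu]_x (a * f x) = a * \int[mu]_x f x.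
Proof. by move=> cf; apply: RintegralZl => //; exact: continuous_integrable. Qed.

Lemma Rintegral_mono (f g : K -> R) : continuous f -> continuous g ->
  (forall x, f x <= g x) -> \int[mu]_x f x <= \int[mu]_x g x.
Proof. by move=> cf cg fg; apply: le_Rintegral => //; exact: continuous_integrable. Qed.

Lemma Rintegral_const (c : R) : \int[mu]_(x in setT) c = c * fine (mu setT).
Proof. exact: Rintegral_cst. Qed.

End BorelIntegral.

(** * The Riesz-Markov theorem *)

Section RieszMarkov.
Context (R : realType) (K : ptopologicalType).
Hypothesis cK : compact [set: K].
Hypothesis hK : hausdorff_space K.
Variable m : (K -> R) -> R.
Hypothesis mD : forall f g : K -> R, continuous f -> continuous g ->
  m (fun x => f x + g x) = m f + m g.
Hypothesis mZ : forall (a : R) (f : K -> R), continuous f -> m (fun x => a * f x) = a * m f.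
Hypothesis m_ge0 : forall f : K -> R, continuous f -> (forall x, 0 <= f x) -> 0 <= m f.

Lemma functional_le (f g : K -> R) : continuous f -> continuous g -> (forall x, f x <= g x) -> m f <= m g.
Proof.
move=> cf cg fg.
have cN : continuous (fun x => -1 * f x).
  by apply: continuous_mul cf; exact: continuous_const.
have : 0 <= m (fun x => g x + -1 * f x).
  by apply: m_ge0 => [|x]; [exact: continuous_add | rewrite mulN1r subr_ge0].
by rewrite mD// mZ//; lra.
Qed.

Let mass : R := m (fun _ => 1).

Let mass_ge0 : 0 <= mass.
Proof. by apply: m_ge0 => //; exact: continuous_const. Qed.

Lemma functional_cst c : m (fun _ => c) = c * mass.
Proof.
have := mZ c (@continuous_const R K 1).
by under eq_fun do rewrite mulr1.
Qed.

(** Vanishing off [U] is weaker than having closed support inside [U]; truncation restores a closed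
    set inside [U] at a cost of [e * mass]. *)
Definition below_indicator (U : set K) (f : K -> R) : Prop :=
  [/\ continuous f, forall x, 0 <= f x <= 1 & forall x, ~ U x -> f x = 0].

Definition content_of_open (U : set K) : R :=
  sup [set r | exists2 f, below_indicator U f & r = m f].

Local Notation lam := content_of_open.

Let below0 U : below_indicator U (fun _ => 0).
Proof. by split => //; [exact: continuous_const | move=> x; rewrite lexx ler01]. Qed.

Let lam_nonempty U : [set r | exists2 f, below_indicator U f & r = m f] !=set0.
Proof. by exists (m (fun _ => 0)); exists (fun _ => 0). Qed.

Let lam_ubound U :
  has_ubound [set r | exists2 f, below_indicator U f & r = m f].
Proof.
exists mass => _ [f [cf f01 _] ->]; apply: functional_le => //.
  exact: continuous_const.
by move=> x; have /andP[] := f01 x.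
Qed.

Lemma below_indicator_le U f : below_indicator U f -> m f <= lam U.
Proof. by move=> Uf; apply: ub_le_sup; [exact: lam_ubound | exists f]. Qed.

Lemma content_of_open_le U c : (forall f, below_indicator U f -> m f <= c) -> lam U <= c.
Proof. by move=> H; apply: ge_sup => // _ [f Uf ->]; exact: H. Qed.

Lemma content_of_open_ge0 U : 0 <= lam U.
Proof. by have := below_indicator_le (below0 U); rewrite functional_cst mul0r. Qed.

Lemma content_of_open_mono U V : U `<=` V -> lam U <= lam V.
Proof.
move=> UV; apply: content_of_open_le => f [cf f01 fU]; apply: below_indicator_le.
by split => // x nV; apply: fU => /UV.
Qed.

Lemma content_of_open_le_mass U : lam U <= mass.
Proof.
apply: content_of_open_le => f [cf f01 _]; apply: functional_le => //.
  exact: continuous_const.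
by move=> x; have /andP[] := f01 x.
Qed.

Lemma content_of_openT : lam setT = mass.
Proof.
apply/eqP; rewrite eq_le content_of_open_le_mass /=.
apply: below_indicator_le; split => [|x|x nT].
- exact: continuous_const.
- by rewrite lexx ler01.
- by exfalso; exact: nT.
Qed.

Lemma content_of_open0 : lam set0 = 0.
Proof.
apply/eqP; rewrite eq_le content_of_open_ge0 andbT.
apply: content_of_open_le => f [cf _ f0].
by rewrite (_ : f = fun _ => 0) ?functional_cst ?mul0r//; apply/funext => x; exact: f0.
Qed.

(* Truncating [f] from below by [e] makes it vanish off the closed set [e <= f]. *)
Let trunc (e : R) (f : K -> R) (x : K) : R := Num.max (f x - e) 0.

Let trunc_cont e (f : K -> R) : continuous f -> continuous (trunc e f).
Proof.
move=> cf; apply: maxr_continuous; last exact: continuous_const.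
by apply: continuous_sub => //; exact: continuous_const.
Qed.

Let trunc01 e f x : 0 < e -> 0 <= f x <= 1 -> 0 <= trunc e f x <= 1.
Proof.
move=> e0 /andP[f0 f1]; rewrite /trunc le_max lexx orbT /= ge_max ler01 andbT.
lra.
Qed.

Let trunc_eq0 e f x : ~ (e <= f x) -> trunc e f x = 0.
Proof. by move=> /negP; rewrite -ltNge => fe; rewrite /trunc max_r// subr_le0 ltW. Qed.

Let trunc_approx e (f : K -> R) : continuous f -> m f <= m (trunc e f) + e * mass.
Proof.
move=> cf; rewrite -functional_cst -mD; [|exact: trunc_cont|exact: continuous_const].
apply: functional_le => //.
  by apply: continuous_add; [exact: trunc_cont|exact: continuous_const].
by move=> x; rewrite /trunc -lerBlDr le_max lexx.
Qed.

Let arbitrarily_small (x y : R) : (forall e, 0 < e -> x <= y + e * mass) -> x <= y.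
Proof.
move=> H; apply/ler_addgt0Pl => e e0.
have m1 : 0 < mass + 1 by rewrite ltr_wpDl.
have := H (e / (mass + 1)); rewrite divr_gt0// => /(_ isT) /le_trans; apply.
rewrite addrC lerD2r -mulrA ler_piMr ?(ltW e0)//.
by rewrite ler_pdivrMl// mulr1 lerDl.
Qed.

(** The closed sets [C \ U] and [C \ V] are disjoint, so a Urysohn function [h] splits the truncated
    [f] into [h * trunc e f] below [U] and [(1 - h) * trunc e f] below [V]. *)
Lemma content_of_openU U V : open U -> open V -> lam (U `|` V) <= lam U + lam V.
Proof.
move=> oU oV; apply: content_of_open_le => f [cf f01 fUV].
apply: arbitrarily_small => e e0.
pose C := [set x | e <= f x].
have cC : closed C by exact: closed_preimage_ge.
have CUV x : C x -> U x \/ V x.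
  move=> Cx; have [//|/fUV fx0] := pselect ((U `|` V) x).
  by move: Cx; rewrite /C /= fx0 leNgt e0.
have [h [ch h01 hU hV]] : exists h : K -> R, [/\ continuous h, forall x, 0 <= h x <= 1,
    forall x, (C `\` U) x -> h x = 0 & forall x, (C `\` V) x -> h x = 1].
  apply: urysohn_compact => //; try by apply: closedI => //; exact: open_closedC.
  apply/seteqP; split => // x [[Cx nU] [_ nV]].
  by case: (CUV x Cx).
have c1h : continuous (fun x => 1 - h x).
  by apply: continuous_sub => //; exact: continuous_const.
have ct : continuous (trunc e f) by exact: trunc_cont.
apply: (le_trans (@trunc_approx e f cf)); rewrite lerD2r.
rewrite (_ : trunc e f = fun x => h x * trunc e f x + (1 - h x) * trunc e f x); last first.
  by apply/funext => x; ring.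
rewrite mD; [|exact: continuous_mul|exact: continuous_mul].
apply: lerD; apply: below_indicator_le; split.
- exact: continuous_mul.
- move=> x; have /andP[h0 h1] := h01 x; have /andP[t0 t1] := trunc01 e0 (f01 x).
  by rewrite mulr_ge0//= mulr_ile1.
- move=> x nUx; have [Cx|/trunc_eq0 ->] := pselect (C x); last by rewrite mulr0.
  by rewrite hU// mul0r.
- exact: continuous_mul.
- move=> x; have /andP[h0 h1] := h01 x; have /andP[t0 t1] := trunc01 e0 (f01 x).
  by rewrite mulr_ge0//= ?subr_ge0// mulr_ile1// ?subr_ge0// lerBlDr lerDl.
- move=> x nVx; have [Cx|/trunc_eq0 ->] := pselect (C x); last by rewrite mulr0.
  by rewrite hV// subrr mul0r.
Qed.

(** Compactness reduces this to finite unions: the set where [e <= f] is already covered by finitely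
    many [U n]. *)
Lemma content_of_open_bigcup (U : nat -> set K) : (forall n, open (U n)) ->
  ((lam (\bigcup_n U n))%:E <= \sum_(n <oo) (lam (U n))%:E)%E.
Proof.
move=> oU.
have lam_bigU n : lam (\bigcup_(i < n) U i) <= \sum_(i < n) lam (U i).
  elim: n => [|n IH].
    by rewrite big_ord0 bigcup_mkord big_ord0 content_of_open0.
  rewrite big_ord_recr /= bigcup_mkord big_ord_recr /= -bigcup_mkord.
  apply: le_trans (content_of_openU _ _) _ => //; last by rewrite lerD2r.
  exact: bigcup_open.
have sum_lt n : ((\sum_(i < n) lam (U i))%:E <= \sum_(n <oo) (lam (U n))%:E)%E.
  rewrite -sumEFin -(big_mkord xpredT (fun i => (lam (U i))%:E)).
  apply: (nneseries_lim_ge n) => k _ _.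
  by rewrite lee_fin content_of_open_ge0.
have [fin|] := boolP ((\sum_(n <oo) (lam (U n))%:E)%E \is a fin_num); last first.
  rewrite ge0_fin_numE; last first.
    by apply: nneseries_ge0 => n _ _; rewrite lee_fin content_of_open_ge0.
  by rewrite -leNgt leye_eq => /eqP ->; rewrite leey.
rewrite -(fineK fin) lee_fin; apply: content_of_open_le => f [cf f01 fU].
apply: arbitrarily_small => e e0.
pose C := [set x | e <= f x].
have cC : compact C.
  by apply: (subclosed_compact _ cK) => //; exact: closed_preimage_ge.
have [|||n Cn] := @compact_increasing_cover K C (fun n => \bigcup_(i < n) U i) cC.
- by move=> n; exact: bigcup_open.
- by move=> p q pq x [i /= ip Ux]; exists i => //=; exact: leq_trans pq.
- move=> x Cx; have [[i _ Uix]|nU] := pselect ((\bigcup_n U n) x).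
    by exists i.+1 => //; exists i => //=.
  by move: Cx; rewrite /C /= fU// leNgt e0.
apply: (le_trans (@trunc_approx e f cf)); rewrite lerD2r.
apply: (@le_trans _ _ (\sum_(i < n) lam (U i))); last first.
  by rewrite -lee_fin fineK.
apply: le_trans (lam_bigU n); apply: below_indicator_le; split.
- exact: trunc_cont.
- by move=> x; exact: trunc01.
- by move=> x nU; apply: trunc_eq0 => Cx; apply: nU; exact: Cn.
Qed.

(* The value [+oo] leaves only open covers to the outer measure [mu_ext mu0]. *)
Let mu0 (U : set (Borel K)) : \bar R := if `[< @open K U >] then (lam U)%:E else +oo%E.

Let mu0_0 : mu0 set0 = 0%E.
Proof.
rewrite /mu0; case: asboolP => [_|]; first by rewrite content_of_open0.
by move=> /(_ open0).
Qed.

Let mu0_ge0 X : (0 <= mu0 X)%E.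
Proof. by rewrite /mu0; case: asboolP => _; rewrite ?lee_fin ?content_of_open_ge0 ?leey. Qed.

Let mu0E U : open U -> mu0 U = (lam U)%:E.
Proof. by move=> oU; rewrite /mu0; case: asboolP. Qed.

Let mu : {outer_measure set (Borel K) -> \bar R} :=
  HB.pack (mu_ext mu0) (isOuterMeasure.Build R (Borel K) (mu_ext mu0)
    (mu_ext0 mu0_0 mu0_ge0) (mu_ext_ge0 mu0_ge0) (@le_mu_ext _ _ _ mu0)
    (mu_ext_sigma_subadditive mu0_ge0)).

Let mu_le_open (U : set K) : open U -> (mu U <= (lam U)%:E)%E.
Proof.
move=> oU; apply: ereal_inf_lbound.
exists (fun n => if n is 0%N then U else set0).
  split=> [[|i]|x Ux]; [exact: open_Borel | exact: measurable0 | by exists 0%N].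
rewrite nneseries_recl//.
by rewrite eseries_cond /= eseries0 ?adde0 ?mu0E// => -[|]//= k _ _; rewrite mu0_0.
Qed.

Let mu_le_mass E : (mu E <= mass%:E)%E.
Proof.
apply: (@le_trans _ _ (mu setT)); first exact: le_outer_measure.
by rewrite -content_of_openT; apply: mu_le_open; exact: openT.
Qed.

Let mu_fin E : mu E \is a fin_num.
Proof.
by rewrite ge0_fin_numE ?outer_measure_ge0// (le_lt_trans (mu_le_mass E))// ltry.
Qed.

Let outer_open (E : set K) e : 0 < e ->
  exists U, [/\ open U, E `<=` U & ((lam U)%:E <= mu E + e%:E)%E].
Proof.
move=> e0; have [_ [U [mU EU] <-] sumU] := lb_ereal_inf_adherent e0 (mu_fin E).
have oU n : @open K (U n).
  (* A cover with a member that is not open has infinite total, so a nearly optimal cover is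
     open. *)
  have [//|nO] := pselect (@open K (U n)); exfalso.
  move: sumU; rewrite (@eseries_pinfty _ _ _ n)//.
  - by rewrite ltNge leey.
  - by move=> k _; rewrite gt_eqF// (lt_le_trans _ (mu0_ge0 _)).
  - by rewrite /mu0; case: asboolP.
exists (\bigcup_n U n); split => //; first by apply: bigcup_open => n _; exact: oU.
apply: (le_trans (content_of_open_bigcup oU)); apply: le_trans (ltW sumU).
by apply: lee_nneseries => [n _ _|n _]; [rewrite lee_fin content_of_open_ge0 | rewrite mu0E].
Qed.

Let lam_le_mu (U : set K) : ((lam U)%:E <= mu U)%E.
Proof.
apply/lee_addgt0Pr => e e0; have [V [oV UV lV]] := outer_open U e0.
by apply: le_trans lV; rewrite lee_fin; exact: content_of_open_mono.
Qed.

(** A truncated [f] below [V] and [U] vanishes off [C], so any [g] below [V \ C] can be added to it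
    without exceeding 1; and [V \ C] contains [V \ U]. *)
Let content_of_open_split (U V : set K) : open U -> open V ->
  ((lam (V `&` U))%:E + mu (V `\` U) <= (lam V)%:E)%E.
Proof.
move=> oU oV; rewrite -(fineK (mu_fin _)) -EFinD lee_fin -lerBrDr.
apply: content_of_open_le => f [cf f01 fVU].
rewrite lerBrDr; apply: arbitrarily_small => e e0.
pose C := [set x | e <= f x].
have cC : closed C by exact: closed_preimage_ge.
have CVU x : C x -> V x /\ U x.
  move=> Cx; have [//|/fVU fx0] := pselect ((V `&` U) x).
  by move: Cx; rewrite /C /= fx0 leNgt e0.
have oVC : open (V `\` C) by apply: openI => //; exact: closed_openC.
have muVC : fine (mu (V `\` U)) <= lam (V `\` C).
  rewrite -lee_fin fineK//; apply: le_trans (mu_le_open oVC).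
  by apply: le_outer_measure => x [Vx nUx]; split => // /CVU [].
have : lam (V `\` C) <= lam V - m (trunc e f).
  apply: content_of_open_le => g [cg g01 gVC].
  rewrite lerBrDr -mD//; last exact: trunc_cont.
  apply: below_indicator_le; split.
  - by apply: continuous_add => //; exact: trunc_cont.
  - move=> x; have /andP[t0 t1] := trunc01 e0 (f01 x); have /andP[g0 g1] := g01 x.
    rewrite addr_ge0//=; have [Cx|nCx] := pselect (C x).
      by rewrite gVC ?add0r// => -[].
    by rewrite (trunc_eq0 nCx) addr0.
  - move=> x nVx; rewrite gVC; last by move=> [].
    by rewrite trunc_eq0 ?addr0// => /CVU [].
have := @trunc_approx e f cf; lra.
Qed.

Let open_caratheodory (U : set K) : open U -> mu.-caratheodory U.
Proof.
move=> oU; apply: le_caratheodory_measurable => X.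
apply/lee_addgt0Pr => e e0; have [V [oV XV lV]] := outer_open X e0.
apply: le_trans lV; apply: le_trans (content_of_open_split oU oV).
apply: leeD; last by apply: le_outer_measure; exact: setSI.
apply: (@le_trans _ _ (mu (V `&` U))); first by apply: le_outer_measure; exact: setSI.
by apply: mu_le_open; exact: openI.
Qed.

Let Borel_caratheodory (A : set (Borel K)) : measurable A -> mu.-caratheodory A.
Proof.
apply: smallest_sub; last by move=> U oU; exact: open_caratheodory.
split.
- exact: caratheodory_measurable_set0.
- by move=> B mB; rewrite setTD; exact: caratheodory_measurable_setC.
- by move=> F mF; exact: caratheodory_measurable_bigcup.
Qed.

Let mu_sigma_additive : semi_sigma_additive (mu : set (Borel K) -> \bar R).
Proof.
move=> F mF tF mbF.
apply: (@caratheodory_measure_sigma_additive R (Borel K) mu) => //.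
- by move=> n; exact: Borel_caratheodory.
- exact: Borel_caratheodory.
Qed.

Let riesz_measure : {measure set (Borel K) -> \bar R} :=
  HB.pack (mu : set (Borel K) -> \bar R)
    (isMeasure.Build _ (Borel K) R (mu : set (Borel K) -> \bar R)
      (outer_measure0 mu) (outer_measure_ge0 mu) mu_sigma_additive).

Local Notation nu := riesz_measure.

Let nuE (A : set (Borel K)) : nu A = mu A. Proof. by []. Qed.

Let nu_open (U : set K) : open U -> nu U = (lam U)%:E.
Proof. by move=> oU; apply/eqP; rewrite nuE eq_le mu_le_open// lam_le_mu. Qed.

Let nuT : nu setT = mass%:E.
Proof. by rewrite nu_open ?content_of_openT//; exact: openT. Qed.

(** Inner regularity is outer regularity of the complement, since closed sets are compact and the
    mass is finite. *)
Let nu_radon : radon nu.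
Proof.
split; first by rewrite nuT ltry.
move=> B mB e e0; have [U [oU BU lU]] := outer_open (~` B) e0.
have cUC : closed (~` U) by exact: open_closedC.
exists (~` U); split.
- exact: (subclosed_compact cUC cK).
- by apply: subsetCl.
- have mU : measurable (U : set (Borel K)) by exact: open_Borel.
  have nuC (X : set (Borel K)) : measurable X -> nu X = (mass - fine (nu (~` X)))%:E.
    move=> mX; rewrite EFinB fineK; last by rewrite nuE.
    rewrite -nuT; have -> : nu setT = (nu X + nu (~` X))%E.
      by rewrite -measureU ?setvU ?setUv//; [exact: measurableC | exact: setICr].
    by rewrite addeK// nuE.
  rewrite (nuC B mB) (nuC (~` U)); last exact: measurableC.
  rewrite setCK -EFinD lee_fin.
  have : (nu U <= nu (~` B) + e%:E)%E by rewrite nu_open.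
  rewrite -(@fineK _ (nu U)) ?nuE// -(@fineK _ (mu (~` B)))// -EFinD lee_fin; lra.
Qed.

(* The layer-cake bound, one unit slice at a time. *)
Let functional_le_slices n (f : K -> R) : continuous f -> (forall x, 0 <= f x <= n%:R) ->
  ((m f)%:E <= \int[nu]_x (f x)%:E + nu [set x | (0 < f x)%R])%E.
Proof.
elim: n f => [|n IH] f cf fn.
  have -> : f = fun _ => 0.
    by apply/funext => x; apply/eqP; rewrite eq_le andbC; exact: fn.
  rewrite functional_cst mul0r; apply: adde_ge0 => //.
  by apply: integral_ge0 => x _.
pose f1 x := Num.min (f x) 1; pose f2 x := Num.max (f x - 1) 0.
have c1 := @continuous_const R K 1.
have cf1 : continuous f1 by exact: minr_continuous.
have cf2 : continuous f2 by exact: trunc_cont.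
have -> : m f = m f1 + m f2.
  rewrite -mD//; congr m; apply/funext => x; rewrite /f1 /f2.
  by case: (lerP (f x) 1) => h; [rewrite max_r; lra | rewrite max_l; lra].
have H1 : (m f1 <= lam [set x | 0 < f x]).
  apply: below_indicator_le; split => //.
    move=> x; have /andP[f0 _] := fn x.
    by rewrite /f1 le_min f0 ler01 /= ge_min lexx orbT.
  move=> x /negP; rewrite -leNgt => fx0; rewrite /f1 min_l; last by lra.
  by apply/eqP; rewrite eq_le fx0; have /andP[] := fn x.
have f2n x : 0 <= f2 x <= n%:R.
  have /andP[f0 f1'] := fn x; rewrite /f2 le_max lexx orbT /= ge_max ler0n andbT.
  by rewrite lerBlDr natr1.
have := IH f2 cf2 f2n => H2.
have o0 : open [set x | 0 < f x] by exact: open_preimage_lt.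
have o2 : open [set x | 0 < f2 x] by exact: open_preimage_lt.
have mf : measurable_fun [set: Borel K] (EFin \o f).
  by apply/measurable_EFinP; exact: continuous_Borel.
have mf2 : measurable_fun [set: Borel K] (EFin \o f2).
  by apply/measurable_EFinP; exact: continuous_Borel.
rewrite EFinD addeC; apply: leeD; last by rewrite nu_open.
apply: (le_trans H2).
have mi : measurable_fun [set: Borel K] (EFin \o (\1_[set x | 0 < f2 x] : Borel K -> R)).
  by apply/measurable_EFinP; apply: measurable_indic; exact: open_Borel.
rewrite -[X in (_ + nu X)%E]setIT -integral_indic//; last exact: open_Borel.
rewrite -ge0_integralD//; first last.
- by move=> x _; rewrite lee_fin; have /andP[] := f2n x.
(* Where [f2] is positive it equals [f - 1], which leaves room for the indicator below [f];
   elsewhere the left side is 0. *)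
apply: ge0_le_integral => //.
- move=> x _; apply: adde_ge0; rewrite lee_fin//.
  by have /andP[] := f2n x.
- exact: emeasurable_funD.
- move=> x _; rewrite -EFinD lee_fin indicE.
  have /andP[f0 _] := fn x.
  have [|/negP] := boolP (x \in _); rewrite inE /= /f2.
    by case: (lerP (f x - 1) 0) => //; lra.
  by move=> /negP; rewrite -leNgt; case: (lerP (f x - 1) 0) => //; lra.
Qed.

(** The slice bound has an additive error of at most [mass]; applied to [e^-1 * f], it leaves only
    [e * mass]. *)
Let Rintegral_ge_functional (f : K -> R) : continuous f -> (forall x, 0 <= f x) ->
  m f <= \int[nu]_x f x.
Proof.
move=> cf f0.
have nufin : (nu setT < +oo)%E by case: nu_radon.
have bound (g : K -> R) : continuous g -> (forall x, 0 <= g x) -> m g <= \int[nu]_x g x + mass.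
  move=> cg g0; have [B B0 gB] := continuous_bounded cK cg.
  have := @functional_le_slices (Num.bound B) g cg.
  have gb x : 0 <= g x <= (Num.bound B)%:R.
    rewrite g0 /= (le_trans (ler_norm _))// (le_trans (gB x))//.
    by rewrite ltW// archi_boundP.
  move=> /(_ gb); rewrite (integral_RintegralE cK nufin)// => H.
  rewrite -lee_fin EFinD; apply: (le_trans H); apply: leeD => //.
  by rewrite nuE.
apply: arbitrarily_small => e e0.
have ce : continuous (fun x => e^-1 * f x).
  by apply: continuous_mul => //; exact: continuous_const.
have := bound _ ce; rewrite (Rintegral_scale cK nufin)// mZ// => H.
have {}H := H (fun x => mulr_ge0 (ltW (ltac:(by rewrite invr_gt0) : 0 < e^-1)) (f0 x)).
have : e * (e^-1 * m f) <= e * (e^-1 * \int[nu]_x f x + mass) by rewrite ler_pM2l.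
by rewrite mulrDr !mulrA divff ?gt_eqF// !mul1r.
Qed.

(** The inequality for nonnegative functions extends to all by adding a constant, on which both
    sides agree; applied to [- f] it becomes the reverse inequality. *)
Theorem riesz_markov : exists mu : {measure set (Borel K) -> \bar R},
  radon mu /\ forall f : K -> R, continuous f -> \int[mu]_x f x = m f.
Proof.
exists nu; split=> [//|f cf].
have nufin : (nu setT < +oo)%E by case: nu_radon.
have [B B0 fB] := continuous_bounded cK cf.
have cB := @continuous_const R K B.
have eqm (g : K -> R) : continuous g -> m (fun x => B + g x) <= \int[nu]_x (B + g x) ->
    m g <= \int[nu]_x g x.
  move=> cg; rewrite (Rintegral_add cK nufin)// mD// functional_cst.
  by rewrite Rintegral_const nuT /= lerD2l.
apply/eqP; rewrite eq_le; apply/andP; split; last first.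
  apply: eqm => //; apply: Rintegral_ge_functional; first exact: continuous_add.
  by move=> x; have := fB x; rewrite ler_norml => /andP[]; lra.
have cN : continuous (fun x => -1 * f x).
  by apply: continuous_mul => //; exact: continuous_const.
have : m (fun x => -1 * f x) <= \int[nu]_x (-1 * f x).
  apply: eqm => //; apply: Rintegral_ge_functional; first exact: continuous_add.
  by move=> x; have := fB x; rewrite ler_norml => /andP[]; lra.
by rewrite (Rintegral_scale cK nufin)// mZ// !mulN1r lerN2.
Qed.

End RieszMarkov.

(** * Minimizing measures *)

Section Minimizer.
Context (R : realType) (M : Type) (d : M -> M -> R) (K : ptopologicalType) (iota : Mt M -> K).
Hypothesis hd : is_metric d.
Hypothesis cK : compact [set: K].
Hypothesis hK : hausdorff_space K.

Lemma in_G_add g h : in_G d iota g -> in_G d iota h -> in_G d iota (fun k => g k + h k).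
Proof.
move=> [cg Gg] [ch Gh]; split; first exact: continuous_add.
by move=> x u y xu uy xy; have := lerD (Gg x u y xu uy xy) (Gh x u y xu uy xy); lra.
Qed.

Lemma in_G_scale (a : R) g : 0 <= a -> in_G d iota g -> in_G d iota (fun k => a * g k).
Proof.
move=> a0 [cg Gg]; split.
  by apply: continuous_mul => //; exact: continuous_const.
move=> x u y xu uy xy; have := ler_wpM2l a0 (Gg x u y xu uy xy).
by rewrite mulrDr !(mulrCA a).
Qed.

Lemma in_G_const (c : R) : 0 <= c -> in_G d iota (fun=> c).
Proof.
move=> c0; split; first exact: continuous_const.
by move=> x u y _ _ _; rewrite -mulrDl ler_wpM2r//; case: hd => _ [_ [_]]; exact.
Qed.

Variable nu : {measure set (Borel K) -> \bar R}.
Hypothesis nufin : (nu setT < +oo)%E.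

(* Linear functionals on C(K) below this sublinear one are the measures [mu] with [prec mu nu]. *)
Let upper (h : K -> R) : R :=
  inf [set r | exists2 g, in_G d iota g /\ (forall k, h k <= g k) & r = \int[nu]_k g k].

Let upper_nonempty h : continuous h ->
  [set r | exists2 g, in_G d iota g /\ (forall k, h k <= g k) & r = \int[nu]_k g k] !=set0.
Proof.
move=> ch; have [B B0 hB] := continuous_bounded cK ch.
exists (\int[nu]_k B); exists (fun=> B) => //; split; first exact: in_G_const.
by move=> k; rewrite (le_trans (ler_norm _)).
Qed.

Let upper_lbound h : continuous h -> has_lbound
  [set r | exists2 g, in_G d iota g /\ (forall k, h k <= g k) & r = \int[nu]_k g k].
Proof.
move=> ch; exists (\int[nu]_k h k) => _ [g [[cg _] hg] ->].
exact: Rintegral_mono.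
Qed.

Let upper_le h g : continuous h -> in_G d iota g -> (forall k, h k <= g k) ->
  upper h <= \int[nu]_k g k.
Proof. by move=> ch Gg hg; apply: ge_inf; [exact: upper_lbound | exists g]. Qed.

Let CK : set (K -> R^o) := [set f | continuous (f : K -> R)].

Let CK_subspace : @subspace_on R (K -> R^o) CK.
Proof.
split.
- exact: (@continuous_const R K 0).
- by move=> f g cf cg; exact: (@continuous_add R K f g).
- move=> a f cf; apply: (@continuous_mul R K (fun=> a) f) => //.
  exact: continuous_const.
Qed.

Let upper_sublinear : @sublinear_on R (K -> R^o) CK upper.
Proof.
split.
- move=> t f cf t0; apply: inf_leM => //.
  + exact: upper_nonempty.
  + apply: upper_lbound; apply: (@continuous_mul R K (fun=> t) f) => //.
    exact: continuous_const.
  + move=> _ [g [Gg fg] ->]; exists (\int[nu]_k (t * g k)).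
      exists (fun k => t * g k) => //; split; first exact: in_G_scale (ltW t0) Gg.
      by move=> k; rewrite ler_pM2l// fg.
    by rewrite Rintegral_scale//; case: Gg.
- move=> f g cf cg; apply: inf_leD.
  + exact: upper_nonempty.
  + exact: upper_nonempty.
  + by apply: upper_lbound; exact: (@continuous_add R K f g).
  + move=> _ _ [f' [Gf ff] ->] [g' [Gg gg] ->]; exists (\int[nu]_k (f' k + g' k)).
      exists (fun k => f' k + g' k) => //; split; first exact: in_G_add.
      by move=> k; apply: lerD.
    by rewrite Rintegral_add//; [case: Gf | case: Gg].
Qed.

(* [mu] minimizes the integral of [phi] among the measures below [nu]; by duality the minimality is
   witnessed by functions of G above [- phi]. *)
Theorem exists_minimizer (phi : K -> R) : continuous phi ->
  exists mu : {measure set (Borel K) -> \bar R},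
    [/\ radon mu, prec d iota mu nu &
      forall e, 0 < e -> exists g, [/\ in_G d iota g, forall k, - phi k <= g k &
        \int[mu]_k (g k + phi k) <= e]].
Proof.
move=> cphi; have cNphi := continuous_opp cphi.
have [m [[mD mZ] mle mphi]] :=
  @hahn_banach_support R (K -> R^o) CK CK_subspace upper (fun k => - phi k) upper_sublinear cNphi.
have mN (f : K -> R) : continuous f -> m (fun k => -1 * f k) = - m f.
  by move=> cf; rewrite -[RHS]mulN1r; exact: mZ.
(* The zero function is in G and dominates [- f], so [m] is at most 0 at [- f]. *)
have m_ge0 (f : K -> R) : continuous f -> (forall k, 0 <= f k) -> 0 <= m f.
  move=> cf f0; rewrite -oppr_le0 -mN//.
  have cNf : continuous (fun k => -1 * f k).
    by apply: continuous_mul => //; exact: continuous_const.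
  apply: (le_trans (mle _ cNf)).
  apply: (@le_trans _ _ (\int[nu]_k 0)); last by rewrite Rintegral_const mul0r.
  by apply: upper_le => //; [exact: in_G_const | move=> k; rewrite mulN1r oppr_le0].
have [mu [rmu muE]] := riesz_markov cK hK mD mZ m_ge0.
have mufin : (mu setT < +oo)%E by case: rmu.
have muprec g : in_G d iota g -> \int[mu]_k g k <= \int[nu]_k g k.
  move=> Gg; have cg : continuous g by case: Gg.
  by rewrite muE//; apply: (le_trans (mle _ cg)); apply: upper_le.
exists mu; split => //.
  move=> g Gg; have cg : continuous g by case: Gg.
  by rewrite !integral_RintegralE// lee_fin muprec.
move=> e e0.
(* Let [g] be nearly optimal for [upper] at [- phi]. Its [mu]-integral is at most its [nu]-integral,
   and the [mu]-integral of [phi] is exactly minus that infimum, so the sum is below [e]. *)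
have : has_inf [set r | exists2 g, in_G d iota g /\ (forall k, - phi k <= g k) &
    r = \int[nu]_k g k] by split; [exact: upper_nonempty | exact: upper_lbound].
move=> /(inf_adherent e0)[_ [g [Gg phig] ->]] ge.
have cg : continuous g by case: Gg.
exists g; split => //; rewrite Rintegral_add//.
have := muprec g Gg.
have : \int[mu]_k phi k = - upper (fun k => - phi k).
  rewrite -mphi muE// -mN//; congr m; apply/funext => k.
  by rewrite mulN1r opprK.
rewrite /upper; lra.
Qed.

End Minimizer.

(** * Functions on the Stone-Cech compactification *)

Section MetricFacts.
Context (R : realType) (M : Type) (d : M -> M -> R).
Hypothesis hd : is_metric d.

Let d_ge0 x y : 0 <= d x y. Proof. by case: hd. Qed.
Let dxx x : d x x = 0. Proof. by case: hd => _ [H _]; exact/H. Qed.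
Let dC x y : d x y = d y x. Proof. by case: hd => _ [_ [H _]]; exact: H. Qed.
Let dT x y z : d x z <= d x y + d y z. Proof. by case: hd => _ [_ [_ H]]; exact: H. Qed.

(** [w] is the largest 1-Lipschitz minorant of [F], namely the infimum over [z] of [d x z + F z];
    the last clause provides nearly optimal points [z]. *)
Lemma inf_convolution (F : M -> R) : (forall x, 0 <= F x) ->
  exists w : M -> R, [/\ forall x, 0 <= w x <= F x, forall x y, w x <= d x y + w y &
    forall x r, w x < r -> exists z, d x z + F z < r].
Proof.
move=> F0.
pose E x := [set r | exists z, r = d x z + F z].
have E0 x : E x !=set0 by exists (d x x + F x); exists x.
have lE x : lbound (E x) 0 by move=> _ [z ->]; exact: addr_ge0.
have hE x : has_lbound (E x) by exists 0.
exists (fun x => inf (E x)); split.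
- move=> x; rewrite lb_le_inf//=; apply: ge_inf => //.
  by exists x; rewrite dxx add0r.
- move=> x y; rewrite -lerBlDl; apply: lb_le_inf => // _ [z ->].
  rewrite lerBlDl; apply: (@le_trans _ _ (d x z + F z)).
    by apply: ge_inf => //; exists z.
  by rewrite addrA lerD2r.
- move=> x r wr; have [//|_ [z ->] zr] := @inf_lt _ (E x) r _ wr.
  by exists z.
Qed.

Lemma dist_lipschitz (p q : Mt M) :
  `|d (fstMt p) (sndMt p) - d (fstMt q) (sndMt q)| <=
    d (fstMt p) (fstMt q) + d (sndMt p) (sndMt q).
Proof.
move: (fstMt p) (sndMt p) (fstMt q) (sndMt q) => a b x y.
have := dT a x b; have := dT x y b; have := dT x a y; have := dT a b y.
rewrite ler_norml (dC y b) (dC x a); lra.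
Qed.

Lemma mt_continuous_comp2 (f1 f2 : Mt M -> R) (F : R * R -> R) :
  (forall p q, `|f1 p - f1 q| <= d (fstMt p) (fstMt q) + d (sndMt p) (sndMt q)) ->
  (forall p q, `|f2 p - f2 q| <= d (fstMt p) (fstMt q) + d (sndMt p) (sndMt q)) ->
  (forall p, {for (f1 p, f2 p), continuous F}) ->
  mt_continuous d (fun p => F (f1 p, f2 p)).
Proof.
move=> L1 L2 cF p U /(cF p) /nbhs_ballP[e /= e0 eU].
exists e => // q pq; apply: (eU (f1 q, f2 q)); split => /=.
  exact: le_lt_trans (L1 p q) pq.
exact: le_lt_trans (L2 p q) pq.
Qed.

Lemma dist_Mt_gt0 (p : Mt M) : 0 < d (fstMt p) (sndMt p).
Proof.
rewrite lt_neqAle d_ge0 andbT eq_sym; apply/eqP => d0.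
by apply: (svalP p); case: hd => _ [H _]; exact/H.
Qed.

End MetricFacts.

Section StoneCech.
Context (R : realType) (M : Type) (d : M -> M -> R) (K : ptopologicalType) (iota : Mt M -> K).
Hypothesis hd : is_metric d.
Hypothesis hK : is_stone_cech d iota.

Lemma stone_cech_dense (k : K) (U : set K) : nbhs k U -> exists p, U (iota p).
Proof.
move=> kU; case: hK => _ _ _ dense _.
have : closure (range iota) k by rewrite dense.
by move=> /(_ U kU)[_ [[p _ <-] Up]]; exists p.
Qed.

Lemma stone_cech_le (f g : K -> R) : continuous f -> continuous g ->
  (forall p, f (iota p) <= g (iota p)) -> forall k, f k <= g k.
Proof.
move=> cf cg fg k; rewrite leNgt; apply/negP => gf.
have cfg : continuous (fun k => f k - g k) by exact: continuous_sub.
have : nbhs k [set k | 0 < f k - g k].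
  apply: open_nbhs_nbhs; split; [exact: open_preimage_lt | by rewrite /= subr_gt0].
by move=> /stone_cech_dense[p] /=; rewrite subr_gt0 ltNge fg.
Qed.

(* The quotient by [d] of the pseudometric [min (d x y) (w x + w y)], obtained from [d] by
   collapsing the zero set of [w] to a point. *)
Lemma exists_collapse_function (w : M -> R) : (forall x, 0 <= w x) ->
  (forall x y, w x <= d x y + w y) ->
  exists g, [/\ in_G d iota g, forall k, 0 <= g k <= 1 & forall p,
    g (iota p) = Num.min 1 ((w (fstMt p) + w (sndMt p)) / d (fstMt p) (sndMt p))].
Proof.
move=> w0 w1; have [d0 [deq [dC dT]]] := hd.
pose f (p : Mt M) := Num.min 1 ((w (fstMt p) + w (sndMt p)) / d (fstMt p) (sndMt p)).
have f01 p : 0 <= f p <= 1.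
  by rewrite /f le_min ler01 /= ge_min lexx andbT divr_ge0// addr_ge0.
have fb : Defs.bounded_fun f.
  by exists 1 => p; have /andP[f0 f1] := f01 p; rewrite ger0_norm.
have fc : mt_continuous d f.
  apply: (@mt_continuous_comp2 R M d (fun p => w (fstMt p) + w (sndMt p))
    (fun p => d (fstMt p) (sndMt p)) (fun z => Num.min 1 (z.1 / z.2) : R)).
  - move=> p q; have := w1 (fstMt p) (fstMt q); have := w1 (sndMt p) (sndMt q).
    have := w1 (fstMt q) (fstMt p); have := w1 (sndMt q) (sndMt p).
    by rewrite (dC (fstMt q)) (dC (sndMt q)) ler_norml; lra.
  - by move=> p q; exact: dist_lipschitz.
  - move=> p; apply: continuous_min; first exact: cvg_cst.
    apply: continuousM; first exact: cvg_fst.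
    apply: continuousV; first by rewrite gt_eqF// dist_Mt_gt0.
    exact: cvg_snd.
have [g [cg gE]] : exists g : K -> R, continuous g /\ forall p, g (iota p) = f p.
  by case: hK => _ _ _ _; exact.
exists g; split; first split=> //.
- move=> x u y xu uy xy; rewrite !gE /f /fstMt /sndMt /=.
  have posd a b : a <> b -> 0 < d a b by move=> ab; exact: (dist_Mt_gt0 hd (exist _ (a, b) ab)).
  (* Multiplied by [d], the function becomes the collapsed pseudometric, whose triangle inequality
     is a case analysis on the minima. *)
  have E a b : a <> b -> d a b * Num.min 1 ((w a + w b) / d a b) = Num.min (d a b) (w a + w b).
    move=> /posd ab; rewrite minr_pMr ?(ltW ab)// mulr1 mulrCA divff ?mulr1//.
    by rewrite gt_eqF.
  rewrite !E//.
  have := w1 x u; have := w1 y u; rewrite (dC y u).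
  have := dT x u y; have := w0 u; have := w0 x; have := w0 y.
  rewrite /Num.min; do 3 case: ifPn; rewrite -?leNgt; lra.
- move=> k; apply/andP; split.
    by apply: (@stone_cech_le (fun=> 0)) => // [|p]; [exact: continuous_const | rewrite gE; case/andP: (f01 p)].
  by apply: (@stone_cech_le _ (fun=> 1)) => // [|p]; [exact: continuous_const | rewrite gE; case/andP: (f01 p)].
- exact: gE.
Qed.

Lemma exists_inv1p_dist : exists phi : K -> R, continuous phi /\
  forall p, phi (iota p) = (1 + d (fstMt p) (sndMt p))^-1.
Proof.
have d0 : forall x y, 0 <= d x y by case: hd.
case: hK => _ _ _ _; apply.
- exists 1 => p; rewrite ger0_norm ?invr_ge0 ?addr_ge0//.
  by rewrite invf_le1 ?lerDl// ltr_wpDr.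
- apply: (@mt_continuous_comp2 R M d (fun p => d (fstMt p) (sndMt p))
    (fun p => d (fstMt p) (sndMt p)) (fun z => (1 + z.1)^-1 : R)).
  + by move=> p q; exact: dist_lipschitz.
  + by move=> p q; exact: dist_lipschitz.
  + move=> p; apply: continuousV; first by rewrite /= gt_eqF// ltr_wpDr.
    by apply: cvgD; [exact: cvg_cst | exact: cvg_fst].
Qed.

End StoneCech.

(** * Estimates for measures *)

Section EReal.
Context (R : realType) (K : topologicalType) (D : K -> \bar R).
Hypothesis cD : continuous D.

Lemma open_preimage_lte c : open [set k | (D k < c)%E].
Proof. by apply: (@open_comp _ _ D [set y | (y < c)%E]); [move=> x _; exact: cD | exact: open_ereal_lt_ereal]. Qed.

Lemma open_preimage_gte c : open [set k | (c < D k)%E].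
Proof. by apply: (@open_comp _ _ D [set y | (c < y)%E]); [move=> x _; exact: cD | exact: open_ereal_gt_ereal]. Qed.

Lemma closed_preimage_lee c : closed [set k | (D k <= c)%E].
Proof. by apply: (@closed_comp _ _ D [set y | (y <= c)%E]); [move=> x _; exact: cD | exact: closed_ereal_ge_ereal]. Qed.

Lemma closed_preimage_gee c : closed [set k | (c <= D k)%E].
Proof. by apply: (@closed_comp _ _ D [set y | (c <= y)%E]); [move=> x _; exact: cD | exact: closed_ereal_le_ereal]. Qed.

Lemma closed_preimage_eqe c : closed [set k | D k = c].
Proof.
rewrite (_ : [set _ | _] = [set k | (D k <= c)%E] `&` [set k | (c <= D k)%E]).
  by apply: closedI; [exact: closed_preimage_lee | exact: closed_preimage_gee].
apply/seteqP; split => k /= [] => [->|a b]; first by [].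
by apply/eqP; rewrite eq_le a b.
Qed.

End EReal.

Section SmallIntegrals.
Context (R : realType) (K : ptopologicalType).
Hypothesis cK : compact [set: K].
Implicit Types mu nu : {measure set (Borel K) -> \bar R}.

Lemma measurable_cst_indic (c : R) (A : set (Borel K)) : measurable A ->
  measurable_fun setT (fun k : Borel K => c * \1_A k).
Proof.
move=> mA; apply: measurable_funM; first exact: measurable_cst.
exact: measurable_indic.
Qed.

Lemma integral_cst_indic mu (c : R) (A : set (Borel K)) : measurable A -> 0 <= c ->
  (\int[mu]_k (c * \1_A k)%:E = c%:E * mu A)%E.
Proof.
move=> mA c0; under eq_integral do rewrite EFinM.
rewrite ge0_integralZl_EFin//.
- by rewrite integral_indic// setIT.
- by apply/measurable_EFinP; exact: measurable_indic.
Qed.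

Lemma markov_open mu (h : K -> R) (c e : R) (A : set (Borel K)) : (mu setT < +oo)%E ->
  continuous h -> (forall k, 0 <= h k) -> measurable A -> 0 < c ->
  (forall k, A k -> c <= h k) -> \int[mu]_k h k <= c * e -> (mu A <= e%:E)%E.
Proof.
move=> muoo ch h0 mA c0 Ah he.
rewrite -(@lee_pmul2l _ c%:E)// -integral_cst_indic//; last exact: ltW.
apply: (@le_trans _ _ (\int[mu]_k (h k)%:E)%E).
  apply: ge0_le_integral => //.
  - by move=> k _; rewrite lee_fin mulr_ge0// ltW.
  - by apply/measurable_EFinP; exact: measurable_cst_indic.
  - by apply/measurable_EFinP; exact: continuous_Borel.
  - move=> k _; rewrite lee_fin indicE; have [|_] := boolP (k \in A).
      by rewrite inE mulr1; exact: Ah.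
    by rewrite mulr0.
by rewrite integral_RintegralE// -EFinM lee_fin.
Qed.

Lemma Rintegral_small nu (g : K -> R) (C : set (Borel K)) (e : R) :
  (nu setT < +oo)%E -> continuous g -> (forall k, 0 <= g k <= 1) -> measurable C ->
  0 <= e -> (forall k, C k -> g k <= e) -> (nu (~` C) <= e%:E)%E ->
  \int[nu]_k g k <= e * (fine (nu setT) + 1).
Proof.
move=> nuoo cg g01 mC e0 gC nuC.
have mC' : measurable (~` C) by exact: measurableC.
rewrite -lee_fin -(integral_RintegralE cK nuoo cg).
apply: (@le_trans _ _ (\int[nu]_k (e%:E + (1 * \1_(~` C) k)%:E))%E).
  apply: ge0_le_integral => //.
  - by move=> k _; rewrite lee_fin; case/andP: (g01 k).
  - by apply/measurable_EFinP; exact: continuous_Borel.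
  - apply: emeasurable_funD => //; apply/measurable_EFinP.
    exact: measurable_cst_indic.
  - move=> k _; rewrite -EFinD lee_fin mul1r indicE.
    have /andP[g0 g1] := g01 k.
    have [Ck|nCk] := pselect (C k); first by rewrite (le_trans (gC _ Ck))// lerDl.
    by rewrite mem_set// (le_trans g1)// lerDr.
rewrite ge0_integralD//.
- rewrite integral_cst_indic// mul1e integral_cst// mulrDr mulr1 EFinD.
  by apply: leeD => //; rewrite EFinM fineK// ge0_fin_numE.
- by apply/measurable_EFinP; exact: measurable_cst_indic.
Qed.

Lemma measure_eq0_small nu (N : set (Borel K)) : (forall e, 0 < e -> (nu N <= e%:E)%E) ->
  nu N = 0%E.
Proof.
move=> H; apply/eqP; rewrite -measure_le0; apply/lee_addgt0Pr => e e0.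
by rewrite add0e H.
Qed.

(** Supplies the compact sets away from a null set on which the test functions are made small. *)
Lemma radon_open_null nu (N : set (Borel K)) (e : R) : hausdorff_space K -> radon nu ->
  measurable N -> nu N = 0%E -> 0 < e ->
  exists C : set K, [/\ compact C, closed C, C `<=` ~` N & (nu (~` C) <= e%:E)%E].
Proof.
move=> hK [nuoo rnu] mN nuN e0.
have mN' : measurable (~` N) by exact: measurableC.
have [C [cC CN nuC]] := rnu _ mN' _ e0.
have clC : closed C by exact: compact_closed.
have mC : measurable (C : set (Borel K)) by exact: closed_Borel.
have fin (X : set (Borel K)) : measurable X -> nu X \is a fin_num.
  move=> mX; rewrite ge0_fin_numE// (le_lt_trans _ nuoo)//.
  by apply: le_measure; rewrite ?inE.
exists C; split => //.
have split_nu (X : set (Borel K)) : measurable X -> nu setT = (nu X + nu (~` X))%E.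
  move=> mX; rewrite -measureU ?setvU ?setUv//; first exact: measurableC.
  exact: setICr.
have E1 := split_nu C mC; have E2 := split_nu N mN.
have fC := fin _ mC; have fC' := fin _ (measurableC mC); have fN' := fin _ mN'.
move: nuC E1; rewrite E2 nuN add0e.
rewrite -(fineK fC) -(fineK fC') -(fineK fN') -!EFinD !lee_fin => h [] h2.
lra.
Qed.

End SmallIntegrals.

(** * Junctions and null sets *)

Section Compactifications.
Context (R : realType) (M : Type) (d : M -> M -> R) (o : M).
Hypothesis hd : is_metric d.
Context (K : ptopologicalType) (iota : Mt M -> K) (Ku : ptopologicalType) (iu : M -> Ku).
Hypothesis hK : is_stone_cech d iota.
Hypothesis hKu : is_samuel d iu.
Variables (dbar : K -> \bar R) (p1 p2 : K -> Ku) (d0bar : Ku -> \bar R).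
Hypothesis hdbar : continuous dbar.
Hypothesis hdbarE : forall p : Mt M, dbar (iota p) = (d (fstMt p) (sndMt p))%:E.
Hypotheses (hp1 : continuous p1) (hp2 : continuous p2).
Hypothesis hp1E : forall p : Mt M, p1 (iota p) = iu (fstMt p).
Hypothesis hp2E : forall p : Mt M, p2 (iota p) = iu (sndMt p).
Hypothesis hd0bar : continuous d0bar.
Hypothesis hd0barE : forall x : M, d0bar (iu x) = (d x o)%:E.

Let d_ge0 x y : 0 <= d x y. Proof. by case: hd. Qed.
Let dxx x : d x x = 0. Proof. by case: hd => _ [H _]; exact/H. Qed.
Let dC x y : d x y = d y x. Proof. by case: hd => _ [_ [H _]]; exact: H. Qed.
Let dT x y z : d x z <= d x y + d y z. Proof. by case: hd => _ [_ [_ H]]; exact: H. Qed.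
Let cK : compact [set: K]. Proof. by case: hK. Qed.
Let hsK : hausdorff_space K. Proof. by case: hK. Qed.
Let cKu : compact [set: Ku]. Proof. by case: hKu. Qed.
Let hsKu : hausdorff_space Ku. Proof. by case: hKu. Qed.

Let comp1 (f : Ku -> R) : continuous f -> continuous (f \o p1).
Proof. by move=> cf k; apply: continuous_comp; [exact: hp1 | exact: cf]. Qed.
Let comp2 (f : Ku -> R) : continuous f -> continuous (f \o p2).
Proof. by move=> cf k; apply: continuous_comp; [exact: hp2 | exact: cf]. Qed.
Let comp1e (f : Ku -> \bar R) : continuous f -> continuous (f \o p1).
Proof. by move=> cf k; apply: continuous_comp; [exact: hp1 | exact: cf]. Qed.
Let comp2e (f : Ku -> \bar R) : continuous f -> continuous (f \o p2).
Proof. by move=> cf k; apply: continuous_comp; [exact: hp2 | exact: cf]. Qed.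

(* Equality and inequality statements about [k] are transferred from [Mt M] by picking a point of
   [range iota] in a suitable open set containing [k]. *)
Let dense_open (k : K) (U : set K) : open U -> U k -> exists p, U (iota p).
Proof. by move=> oU Uk; apply: (stone_cech_dense hK (k := k)); exact: open_nbhs_nbhs. Qed.

Let unif_cont (f : Ku -> R) : continuous f -> Defs.unif_continuous d (f \o iu).
Proof. by case: hKu => _ _ _ _ [_]; exact. Qed.

Lemma open_RM1 : open [set k | RM d0bar (p1 k)].
Proof. exact: (open_preimage_lte (comp1e hd0bar)). Qed.

Lemma open_RM2 : open [set k | RM d0bar (p2 k)].
Proof. exact: (open_preimage_lte (comp2e hd0bar)). Qed.

Lemma open_calR : open (calR d0bar p1 p2).
Proof. by apply: openI; [exact: open_RM1 | exact: open_RM2]. Qed.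

Lemma dbar_ge0 k : (0 <= dbar k)%E.
Proof.
rewrite leNgt; apply/negP => k0.
have [p] := dense_open (open_preimage_lte hdbar 0%E) k0.
by rewrite /= hdbarE lte_fin ltNge d_ge0.
Qed.

(** A continuous function separating two points of [Ku] is uniformly continuous on [M], so it cannot
    jump by 1/3 on pairs with small distance. *)
Lemma p1_eq_p2_of_dbar0 k : dbar k = 0%E -> p1 k = p2 k.
Proof.
move=> dk; apply: contrapT => np.
have [f [cf f01 f0 f1]] : exists f : Ku -> R, [/\ continuous f, forall x, 0 <= f x <= 1,
    forall x, [set p1 k] x -> f x = 0 & forall x, [set p2 k] x -> f x = 1].
  apply: urysohn_compact => //; try by apply: compact_closed => //; exact: compact_set1.
  by apply/seteqP; split => // x [/= -> /np].
have [|delta delta0 fd] := @unif_cont f cf (3^-1); first by rewrite invr_gt0.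
pose U := [set k' | (dbar k' < delta%:E)%E] `&` [set k' | (f \o p1) k' < 3^-1] `&`
  [set k' | 2 / 3 < (f \o p2) k'].
have [] := @dense_open k U.
- apply: openI; first apply: openI.
  + exact: open_preimage_lte.
  + exact: (open_preimage_gt _ (comp1 cf)).
  + exact: (open_preimage_lt _ (comp2 cf)).
- split; first split; rewrite /= ?dk ?lte_fin//.
  + by rewrite f0// invr_gt0.
  + by rewrite f1//; lra.
- move=> p [[/= ]]; rewrite hdbarE hp1E hp2E lte_fin => /fd /=.
  by rewrite ltr_norml => /andP[]; lra.
Qed.

(** The distance to the set [V] of second coordinates of pairs in [U1], capped at 1, is uniformly
    continuous and extends to [Ku]. It vanishes at [p2 k1], which is [p1 k2], so pairs near [k2]
    start close to [V]. *)
Lemma exists_near_junction k1 k2 (U1 U2 : set K) (delta : R) : p2 k1 = p1 k2 ->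
  nbhs k1 U1 -> nbhs k2 U2 -> 0 < delta ->
  exists p q, [/\ U1 (iota p), U2 (iota q) & d (sndMt p) (fstMt q) < delta].
Proof.
move=> k12 nU1 nU2 delta0.
pose V := [set x | exists2 p, U1 (iota p) & x = sndMt p].
pose F x : R := if pselect (V x) then 0 else 1.
have F0 x : 0 <= F x by rewrite /F; case: pselect.
have [w [w0F wL winf]] := inf_convolution hd F0.
have w_lip x y : `|w x - w y| <= d x y.
  by have := wL x y; have := wL y x; rewrite (dC y x) ler_norml; lra.
have [W [cW WE]] : exists W : Ku -> R, continuous W /\ forall x, W (iu x) = w x.
  case: hKu => _ _ _ _ [ext _]; apply: ext.
  - exists 1 => x; have /andP[w0 wF] := w0F x; rewrite ger0_norm//.
    by apply: (le_trans wF); rewrite /F; case: pselect.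
  - move=> e e0; exists e => // x y xy; exact: le_lt_trans (w_lip x y) xy.
have W0 : W (p2 k1) <= 0.
  rewrite leNgt; apply/negP => Wpos.
  have oW := open_preimage_lt 0 (comp2 cW).
  have : nbhs k1 (U1 `&` [set k | 0 < (W \o p2) k]).
    by apply: filterI => //; exact: open_nbhs_nbhs.
  move=> /(stone_cech_dense hK)[p [U1p]] /=; rewrite hp2E WE.
  have /andP[_] := w0F (sndMt p); rewrite /F.
  case: pselect => [Vp w0|nV]; first by rewrite ltNge w0.
  by exfalso; apply: nV; exists p.
(* The bound 1 forces the nearly optimal point [z] into [V], because [F] is 1 elsewhere. *)
have md0 : 0 < Num.min delta 1 by rewrite lt_min delta0 ltr01.
have oW := open_preimage_gt (Num.min delta 1) (comp1 cW).
have : nbhs k2 (U2 `&` [set k | (W \o p1) k < Num.min delta 1]).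
  apply: filterI => //; apply: open_nbhs_nbhs; split => //=.
  by rewrite -k12; exact: le_lt_trans W0 md0.
move=> /(stone_cech_dense hK)[q [U2q]] /=; rewrite hp1E WE => /winf[z].
rewrite lt_min => /andP[zd z1].
move: zd z1; rewrite /F; case: pselect => [[p U1p zp]|nV] zd z1.
  by exists p, q; split => //; rewrite -zp dC; move: zd; rewrite addr0.
by exfalso; have := d_ge0 (fstMt q) z; move: z1 => /=; lra.
Qed.

Section ExtendedG.
Variable g : K -> R.
Hypothesis Gg : in_G d iota g.
Hypothesis hthree : exists x y z : M, [/\ x <> y, y <> z & x <> z].

(** The value 0 on the diagonal lets junctions whose points coincide obey the same triangle
    inequality. *)
Definition weighted_dist (x y : M) : R :=
  if pselect (x <> y) is left h then d x y * g (iota (exist _ (x, y) h)) else 0.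

Lemma weighted_distE p :
  weighted_dist (fstMt p) (sndMt p) = d (fstMt p) (sndMt p) * g (iota p).
Proof.
rewrite /weighted_dist; case: pselect => [h|[]]; last exact: (svalP p).
congr (_ * g (iota _)); case: p h => [[x y] np] h.
by congr exist; exact: Prop_irrelevance.
Qed.

Let weighted_dist_triangle_neq x u y : x <> u -> u <> y -> x <> y ->
  weighted_dist x y <= weighted_dist x u + weighted_dist u y.
Proof.
move=> xu uy xy; rewrite /weighted_dist.
do 3 (case: pselect => // ?).
by case: Gg => _; exact.
Qed.

(* The only nontrivial triples not covered by the definition of G are [x, u, x]; comparing with a third point
   [z] gives [0 <= weighted_dist x u + weighted_dist u x]. *)
Lemma weighted_dist_triangle x u y : weighted_dist x y <= weighted_dist x u + weighted_dist u y.
Proof.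
have rho0 z : weighted_dist z z = 0 by rewrite /weighted_dist; case: pselect.
have [<-|xu] := pselect (x = u); first by rewrite rho0 add0r.
have [<-|uy] := pselect (u = y); first by rewrite rho0 addr0.
have [<-|xy] := pselect (x = y); last exact: weighted_dist_triangle_neq.
have [z [zx zu]] : exists z, z <> x /\ z <> u.
  have [a [b [c [ab bc ac]]]] := hthree; apply: contrapT => H.
  have E t : t = x \/ t = u.
    by apply: contrapT => /not_orP[tx tu]; apply: H; exists t.
  by case: (E a) (E b) (E c) => [Ea|Ea] [Eb|Eb] [Ec|Ec]; congruence.
rewrite rho0.
have := @weighted_dist_triangle_neq x u z xu (nesym zu) (nesym zx).
have := @weighted_dist_triangle_neq u x z (nesym xu) (nesym zx) (nesym zu).
lra.
Qed.

(* Concatenating [k1] and [k2] through pairs [(x, u)] near [k1] and [(v, y)] near [k2] with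
   [d u v] small. *)
Lemma in_G_junction k1 k2 a b : (forall p, - (1 + d (fstMt p) (sndMt p))^-1 <= g (iota p)) ->
  p2 k1 = p1 k2 -> dbar k1 = a%:E -> dbar k2 = b%:E ->
  - ((a + b) / (1 + (a + b))) <= a * g k1 + b * g k2.
Proof.
move=> glow k12 ka kb.
have cg : continuous g by case: Gg.
have a0 : 0 <= a by rewrite -lee_fin -ka dbar_ge0.
have b0 : 0 <= b by rewrite -lee_fin -kb dbar_ge0.
have [B B0 gB] := continuous_bounded cK cg.
rewrite leNgt; apply/negP => neg.
pose D := fine \o dbar.
have cDa : D x @[x --> k1] --> a by apply: fine_cvg; rewrite -ka; exact: hdbar.
have cDb : D x @[x --> k2] --> b by apply: fine_cvg; rewrite -kb; exact: hdbar.
pose S (z : K * K * R) : R := D z.1.1 + D z.1.2 + z.2.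
(* [z.2] stands for the length of the gap [d u v]. The negated claim makes the limit of [H]
   negative, whereas [H] is nonnegative at actual pairs of [Mt M]. *)
pose H (z : K * K * R) : R := D z.1.1 * g z.1.1 + D z.1.2 * g z.1.2 + z.2 * B + S z / (1 + S z).
have c1 : z.1.1 @[z --> ((k1, k2), 0 : R)] --> k1.
  by apply: (@cvg_comp _ _ _ fst fst _ (nbhs (k1, k2))); exact: cvg_fst.
have c2 : z.1.2 @[z --> ((k1, k2), 0 : R)] --> k2.
  by apply: (@cvg_comp _ _ _ fst snd _ (nbhs (k1, k2))); [exact: cvg_fst | exact: cvg_snd].
have c3 : z.2 @[z --> ((k1, k2), 0 : R)] --> (0 : R) by exact: cvg_snd.
have cD1 : D z.1.1 @[z --> ((k1, k2), 0 : R)] --> a by exact: (cvg_comp _ _ c1 cDa).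
have cD2 : D z.1.2 @[z --> ((k1, k2), 0 : R)] --> b by exact: (cvg_comp _ _ c2 cDb).
have cS : S z @[z --> ((k1, k2), 0 : R)] --> a + b + 0 by apply: cvgD => //; exact: cvgD.
have cH : H z @[z --> ((k1, k2), 0 : R)] -->
    a * g k1 + b * g k2 + 0 * B + (a + b + 0) / (1 + (a + b + 0)).
  apply: cvgD; first apply: cvgD; first apply: cvgD.
  - by apply: cvgM => //; exact: (cvg_comp _ _ c1 (cg k1)).
  - by apply: cvgM => //; exact: (cvg_comp _ _ c2 (cg k2)).
  - by apply: cvgM => //; exact: cvg_cst.
  - apply: cvgM => //; apply: cvgV; first by rewrite gt_eqF//; lra.
    by apply: cvgD => //; exact: cvg_cst.
have : \forall z \near ((k1, k2), 0 : R), H z < 0.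
  apply: (cvgr_lt _ cH).
  by rewrite mul0r !addr0; lra.
move=> [[U12 V] /= [[[U1 U2] /= [nU1 nU2] U12sub] nV] UVH].
have /nbhs_ballP[delta /= delta0 ballV] := nV.
have [p [q [U1p U2q pq]]] := exists_near_junction k12 nU1 nU2 delta0.
move: pq; set s := d _ _ => pq.
have : H ((iota p, iota q), s) < 0.
  apply: UVH; split => /=; first exact: U12sub.
  by apply: ballV; rewrite /ball /= sub0r normrN ger0_norm// d_ge0.
rewrite /H /S /D /= !hdbarE /= -!weighted_distE.
have := weighted_dist_triangle (fstMt p) (fstMt q) (sndMt q).
have := weighted_dist_triangle (fstMt p) (sndMt p) (fstMt q).
have huv : weighted_dist (sndMt p) (fstMt q) <= s * B.
  rewrite /weighted_dist; case: pselect => [h|_]; last by rewrite mulr_ge0// d_ge0.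
  by rewrite ler_wpM2l ?d_ge0// (le_trans (ler_norm _)).
(* [t / (1 + t)] is increasing, so [d x y] may be replaced by its triangle bound; if [x = y] the
   right side is 0. *)
have hxy : - ((d (fstMt p) (sndMt p) + d (fstMt q) (sndMt q) + s) /
    (1 + (d (fstMt p) (sndMt p) + d (fstMt q) (sndMt q) + s))) <=
    weighted_dist (fstMt p) (sndMt q).
  set t := _ + _ + s.
  have t0 : 0 <= t by rewrite /t !addr_ge0 ?d_ge0.
  have t1 : 0 < 1 + t by lra.
  have dt : d (fstMt p) (sndMt q) <= t.
    have := dT (fstMt p) (fstMt q) (sndMt q); have := dT (fstMt p) (sndMt p) (fstMt q).
    rewrite /t /s; lra.
  rewrite /weighted_dist; case: pselect => [h|_]; last by rewrite oppr_le0 divr_ge0// ltW.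
  have := glow (exist _ (fstMt p, sndMt q) h); rewrite {1}/fstMt {1}/sndMt /=.
  set d' := d _ _ in dt *; set g' := g _ => gl.
  have d'0 : 0 <= d' by exact: d_ge0.
  have d'1 : 0 < 1 + d' by lra.
  apply: (@le_trans _ _ (d' * - (1 + d')^-1)); last by rewrite ler_wpM2l.
  rewrite mulrN lerN2 ler_pdivrMr// mulrAC ler_pdivlMr//; nra.
move: huv hxy.
move: (weighted_dist _ _) (weighted_dist _ _) (weighted_dist _ _) (weighted_dist _ _)
  (weighted_dist _ _) => r1 r2 r3 r4 r5.
lra.
Qed.

End ExtendedG.

(** * Passing null sets down the order, and singularity of the marginals *)

Section Transfer.
Variables mu nu : {measure set (Borel K) -> \bar R}.
Hypotheses (rmu : radon mu) (rnu : radon nu) (munu : prec d iota mu nu).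

Let muoo : (mu setT < +oo)%E. Proof. by case: rmu. Qed.
Let nuoo : (nu setT < +oo)%E. Proof. by case: rnu. Qed.

(** Markov's inequality for [mu] costs a factor 2 and the order moves the integral to [nu]; [e']
    absorbs this factor and the mass of [nu]. *)
Lemma prec_null_transfer (N : set (Borel K)) : measurable N ->
  (forall e, 0 < e -> exists g, exists C : set (Borel K),
    [/\ in_G d iota g, forall k, 0 <= g k <= 1, forall k, N k -> 2^-1 <= g k &
      [/\ measurable C, forall k, C k -> g k <= e & (nu (~` C) <= e%:E)%E]]) ->
  mu N = 0%E.
Proof.
move=> mN H; apply: measure_eq0_small => e e0.
pose m1 := fine (nu setT) + 1.
have m1_gt0 : 0 < m1 by rewrite ltr_wpDl// fine_ge0.
pose e' := 2^-1 * e / m1.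
have e'0 : 0 < e' by rewrite divr_gt0// mulr_gt0// invr_gt0.
have [g [C [Gg g01 gN [mC gC nuC]]]] := H _ e'0.
have cg : continuous g by case: Gg.
apply: (@markov_open R K cK mu g 2^-1 e N) => //.
- by move=> k; case/andP: (g01 k).
have := munu Gg; rewrite !integral_RintegralE// lee_fin => /le_trans; apply.
apply: (le_trans (Rintegral_small cK nuoo cg g01 mC (ltW e'0) gC nuC)).
by rewrite /e' -/m1 divfK ?gt_eqF.
Qed.

(** Most of [nu] lives on pairs inside a ball of radius [n], where [w] vanishes. If one coordinate
    stays bounded while [d] is infinite, the other makes [w x + w y] comparable to [d]. *)
Lemma mu_unbounded_null : nu (~` calR d0bar p1 p2) = 0%E ->
  mu [set k | dbar k = +oo%E /\ (RM d0bar (p1 k) \/ RM d0bar (p2 k))] = 0%E.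
Proof.
move=> nuR.
have d0bar_ge0 xi : (0 <= d0bar (p1 xi))%E /\ (0 <= d0bar (p2 xi))%E.
  split; rewrite leNgt; apply/negP => k0.
    have [p] := dense_open (open_preimage_lte (comp1e hd0bar) 0%E) k0.
    by rewrite /= hp1E hd0barE lte_fin ltNge d_ge0.
  have [p] := dense_open (open_preimage_lte (comp2e hd0bar) 0%E) k0.
  by rewrite /= hp2E hd0barE lte_fin ltNge d_ge0.
apply: prec_null_transfer.
  apply: measurableI; first by apply: closed_Borel; exact: closed_preimage_eqe.
  by apply: measurableU; apply: open_Borel; [exact: open_RM1 | exact: open_RM2].
move=> e e0.
have mRC : measurable (~` calR d0bar p1 p2 : set (Borel K)).
  by apply: measurableC; apply: open_Borel; exact: open_calR.
have [C [cC clC CR nuC]] := radon_open_null hsK rnu mRC nuR e0.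
pose O n := [set k | (d0bar (p1 k) < n%:R%:E)%E /\ (d0bar (p2 k) < n%:R%:E)%E].
have oO n : open (O n).
  by apply: openI; [exact: (open_preimage_lte (comp1e hd0bar)) | exact: (open_preimage_lte (comp2e hd0bar))].
have [|||n Cn] := @compact_increasing_cover K C O cC.
- exact: oO.
- by move=> i j ij k [h1 h2]; split; [apply: (lt_le_trans h1) | apply: (lt_le_trans h2)]; rewrite lee_fin ler_nat.
- move=> k Ck; have := CR k Ck; rewrite setCK => -[r1 r2].
  have [h1 h2] := d0bar_ge0 k.
  have f1 : d0bar (p1 k) \is a fin_num by rewrite ge0_fin_numE.
  have f2 : d0bar (p2 k) \is a fin_num by rewrite ge0_fin_numE.
  exists (Num.bound (Num.max (fine (d0bar (p1 k))) (fine (d0bar (p2 k))))) => //.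
  rewrite /O /= -(fineK f1) -(fineK f2) !lte_fin /=.
  have mx : 0 <= Num.max (fine (d0bar (p1 k))) (fine (d0bar (p2 k))).
    by rewrite le_max fine_ge0.
  have := archi_boundP mx; rewrite gt_max => /andP[]; by [].
pose w x := Num.max (d x o - n%:R) 0.
have w0 x : 0 <= w x by rewrite /w le_max lexx orbT.
have wL x y : w x <= d x y + w y.
  rewrite /w; have := dT x y o; have := d_ge0 x y.
  by rewrite /Num.max; do 2 case: ifPn; rewrite -?leNgt; lra.
have [g [Gg g01 gE]] := exists_collapse_function hd hK w0 wL.
have cg : continuous g by case: Gg.
exists g, C; split => //.
- move=> k [koo kRM]; rewrite leNgt; apply/negP => gk.
  have [a Ua] : exists a : R, (d0bar (p1 k) < a%:E)%E \/ (d0bar (p2 k) < a%:E)%E.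
    have [h1 h2] := d0bar_ge0 k.
    case: kRM => kRM.
      exists (fine (d0bar (p1 k)) + 1); left.
      by rewrite EFinD fineK ?ge0_fin_numE// lteDl ?lte_fin// ge0_fin_numE.
    exists (fine (d0bar (p2 k)) + 1); right.
    by rewrite EFinD fineK ?ge0_fin_numE// lteDl ?lte_fin// ge0_fin_numE.
  (* The far coordinate has [w] at least [d - a - n], hence at least half of [d] once [d] exceeds
     [T]. *)
  pose T := 2 * (`|a| + n%:R).
  pose U := [set k | (T%:E < dbar k)%E] `&` [set k | g k < 2^-1] `&`
    ([set k | ((d0bar \o p1) k < a%:E)%E] `|` [set k | ((d0bar \o p2) k < a%:E)%E]).
  have [] := @dense_open k U.
  + apply: openI; first apply: openI.
    * exact: open_preimage_gte.
    * exact: open_preimage_gt.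
    * by apply: openU; [exact: (open_preimage_lte (comp1e hd0bar)) | exact: (open_preimage_lte (comp2e hd0bar))].
  + by split; first split; rewrite //= koo ltry.
  + move=> p [[]] /=; rewrite hdbarE hp1E hp2E !hd0barE !lte_fin gE.
    move=> Td gs Ha.
    have dpos := dist_Mt_gt0 hd p.
    move: gs; apply/negP; rewrite -leNgt le_min; apply/andP; split; first by lra.
    rewrite ler_pdivlMr//.
    have := dT (fstMt p) o (sndMt p); rewrite (dC o).
    have := ler_norm a; have := ler0n R n.
    have w_ge x : d x o - n%:R <= w x by rewrite /w le_max lexx.
    have := w_ge (fstMt p); have := w_ge (sndMt p).
    have := w0 (fstMt p); have := w0 (sndMt p).
    move: Td; rewrite /T; case: Ha; lra.
- split => //; first exact: closed_Borel.
  move=> k Ck; rewrite leNgt; apply/negP => gk.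
  pose U := O n `&` [set k | e < g k].
  have [] := @dense_open k U.
  + by apply: openI; [exact: oO | exact: open_preimage_lt].
  + by split => //; exact: Cn.
  + move=> p [[]] /=; rewrite hp1E hp2E !hd0barE !lte_fin gE => h1 h2.
    have wz x : d x o < n%:R -> w x = 0 by move=> h; rewrite /w max_r//; lra.
    rewrite !wz// addr0 mul0r min_r ?ler01//; lra.
Qed.

(** [w] is a tiny Lipschitz bump around [S]: over [S] it stays positive while [d] tends to 0, so [g]
    is near 1; on the compact [C] either [d] is bounded below or the bump vanishes. *)
Lemma mu_dbar0_compact_null (S : set Ku) : compact S ->
  nu [set k | dbar k = 0%E /\ S (p1 k)] = 0%E ->
  mu [set k | dbar k = 0%E /\ S (p1 k)] = 0%E.
Proof.
move=> cS nuN; set N := (X in mu X).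
have clS : closed S by exact: compact_closed.
have clZ : closed [set k | dbar k = 0%E] by exact: closed_preimage_eqe.
have mN : measurable (N : set (Borel K)).
  apply: closed_Borel; apply: closedI => //.
  by apply: (@closed_comp _ _ p1 S) => // k _; exact: hp1.
apply: prec_null_transfer => // e e0.
have [C [cC clC CN nuC]] := radon_open_null hsK rnu mN nuN e0.
pose S' := p1 @` (C `&` [set k | dbar k = 0%E]).
have cS' : compact S'.
  apply: continuous_compact; first exact: continuous_subspaceT.
  exact: compact_closedI.
have [f [cf f01 fS' fS]] : exists f : Ku -> R, [/\ continuous f, forall x, 0 <= f x <= 1,
    forall x, S' x -> f x = 0 & forall x, S x -> f x = 1].
  apply: urysohn_compact => //; first exact: compact_closed.
  apply/seteqP; split => // x [[k [Ck dk] <-] Sx].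
  by apply: (CN k Ck); split.
pose O n := [set k | (n.+1%:R^-1%:E < dbar k)%E] `|`
  ([set k | (f \o p1) k < 2^-1] `&` [set k | (f \o p2) k < 2^-1]).
have oO n : open (O n).
  apply: openU; first exact: open_preimage_gte.
  by apply: openI; [exact: (open_preimage_gt _ (comp1 cf)) | exact: (open_preimage_gt _ (comp2 cf))].
have [|||n Cn] := @compact_increasing_cover K C O cC.
- exact: oO.
- move=> i j ij k [h|h]; [left|by right].
  by apply: le_lt_trans h; rewrite lee_fin lef_pV2 ?posrE// ler_nat.
- move=> k Ck; have [dk|dk] := eqVneq (dbar k) 0%E.
    have Sk : S' (p1 k) by exists k.
    exists 0%N => //; right; split; rewrite /= -?(p1_eq_p2_of_dbar0 dk) fS' // invr_gt0//.
  have dpos : (0 < dbar k)%E by rewrite lt_neqAle eq_sym dk dbar_ge0.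
  have [koo|kfin] := eqVneq (dbar k) +oo%E.
    by exists 0%N => //; left; rewrite /= koo ltry.
  have fk : dbar k \is a fin_num by rewrite ge0_fin_numE ?ltey// dbar_ge0.
  have fpos : 0 < fine (dbar k) by rewrite fine_gt0// dpos ltey.
  exists (Num.bound (fine (dbar k))^-1) => //; left; rewrite /= -(fineK fk) lte_fin.
  rewrite invf_plt ?posrE//.
  have := archi_boundP (ltW (ltac:(by rewrite invr_gt0) : 0 < (fine (dbar k))^-1)).
  by move=> /lt_trans; apply; rewrite ltr_nat.
(* Then [w x + w y] is at most [eps], which is at most [e * d] wherever [d] exceeds the threshold of
   [O n]. *)
pose eps := e / n.+1%:R.
have eps0 : 0 < eps by rewrite divr_gt0.
pose F x := eps * Num.max (f (iu x) - 2^-1) 0.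
have F0 x : 0 <= F x by rewrite mulr_ge0 ?(ltW eps0)// le_max lexx orbT.
have [w [w0F wL winf]] := inf_convolution hd F0.
have w0 x : 0 <= w x by case/andP: (w0F x).
have wF x : w x <= F x by case/andP: (w0F x).
have [g [Gg g01 gE]] := exists_collapse_function hd hK w0 wL.
have cg : continuous g by case: Gg.
exists g, C; split => //.
- move=> k [dk Sk]; rewrite leNgt; apply/negP => gk.
  have [|delta delta0 fd] := @unif_cont f cf (8^-1); first by rewrite invr_gt0.
  (* If [f] exceeds 3/4 at a point, it exceeds 5/8 within [delta], where [F] is at least [eps / 8];
     so [w] is at least [r] at that point. *)
  pose r := Num.min delta (eps / 8).
  have r0 : 0 < r by rewrite lt_min delta0 divr_gt0.
  pose U := [set k | (dbar k < r%:E)%E] `&` [set k | g k < 2^-1] `&`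
    [set k | 3 / 4 < (f \o p1) k].
  have [] := @dense_open k U.
  + apply: openI; first apply: openI.
    * exact: open_preimage_lte.
    * exact: open_preimage_gt.
    * exact: (open_preimage_lt _ (comp1 cf)).
  + split; first split; rewrite //= ?dk ?lte_fin//.
    by rewrite (fS _ Sk); lra.
  + move=> p [[]] /=; rewrite hdbarE hp1E lte_fin gE => dr gs f34.
    have dpos := dist_Mt_gt0 hd p.
    have wr : r <= w (fstMt p).
      rewrite leNgt; apply/negP => /winf[z]; rewrite lt_min => /andP[h1 h2].
      have dz : d (fstMt p) z < delta by rewrite (le_lt_trans _ h1)// lerDl.
      have := fd _ _ dz; rewrite /= ltr_norml => /andP[_ h3].
      have h4 : F z < eps / 8 by rewrite (le_lt_trans _ h2)// lerDr.
      move: h4; rewrite /F ltr_pM2l// gt_max => /andP[]; lra.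
    move: gs; apply/negP; rewrite -leNgt le_min; apply/andP; split; first by lra.
    by rewrite ler_pdivlMr//; have := w0 (sndMt p); lra.
- split => //; first exact: closed_Borel.
  move=> k Ck; rewrite leNgt; apply/negP => gk.
  pose U := O n `&` [set k | e < g k].
  have [] := @dense_open k U.
  + by apply: openI; [exact: oO | exact: open_preimage_lt].
  + by split => //; exact: Cn.
  + move=> p [On] /=; rewrite gE => ge.
    have dpos := dist_Mt_gt0 hd p.
    case: On => [|[]] /=.
      rewrite hdbarE lte_fin => dn.
      move: ge; apply/negP; rewrite -leNgt ge_min; apply/orP; right.
      rewrite ler_pdivrMr//.
      have Fh x : F x <= eps / 2.
        rewrite /F ler_pM2l// ge_max; apply/andP; split; last by lra.
        by case/andP: (f01 (iu x)) => _; lra.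
      apply: (@le_trans _ _ eps).
        have := wF (fstMt p); have := wF (sndMt p).
        have := Fh (fstMt p); have := Fh (sndMt p); lra.
      by rewrite /eps ler_pM2l// ltW.
    rewrite hp1E hp2E => h1 h2.
    have wz x : f (iu x) < 2^-1 -> w x = 0.
      move=> h; apply/eqP; rewrite eq_le w0 andbT (le_trans (wF x))// /F max_r ?mulr0//.
      by lra.
    move: ge; rewrite !wz// addr0 mul0r min_r ?ler01//; lra.
Qed.

(** Inner regularity of [mu] replaces [A] by the compact image [p1 C] of a compact subset [C] of the
    null set. *)
Lemma mu_dbar0_null (A : set (Borel Ku)) : measurable A ->
  nu [set k | dbar k = 0%E /\ A (p1 k)] = 0%E ->
  mu [set k | dbar k = 0%E /\ A (p1 k)] = 0%E.
Proof.
move=> mA nuN.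
have clZ : closed [set k | dbar k = 0%E] by exact: closed_preimage_eqe.
have mN : measurable ([set k | dbar k = 0%E /\ A (p1 k)] : set (Borel K)).
  apply: measurableI; first exact: closed_Borel.
  exact: (Borel_preimage hp1 mA).
apply: measure_eq0_small => e e0.
have [C [cC CN muC]] := rmu.2 _ mN _ e0.
have cS : compact (p1 @` C).
  by apply: continuous_compact => //; exact: continuous_subspaceT.
have clC : closed C by exact: compact_closed.
have mS : measurable ([set k | dbar k = 0%E /\ (p1 @` C) (p1 k)] : set (Borel K)).
  apply: measurableI; first exact: closed_Borel.
  have mpC : measurable (p1 @` C : set (Borel Ku)).
    by apply: closed_Borel; exact: compact_closed.
  exact: (Borel_preimage hp1 mpC).
have nuS : nu [set k | dbar k = 0%E /\ (p1 @` C) (p1 k)] = 0%E.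
  apply: (subset_measure0 mS mN _ nuN) => k [dk [k' Ck' kk']]; split => //.
  by rewrite -kk'; exact: (CN k' Ck').2.
have muS := mu_dbar0_compact_null cS nuS.
have mC : measurable (C : set (Borel K)) by exact: closed_Borel.
have muC0 : mu C = 0%E.
  apply: (subset_measure0 mC mS _ muS) => k Ck; split; last by exists k.
  exact: (CN k Ck).1.
by move: muC; rewrite muC0 add0e.
Qed.

Lemma inv1p_dist_extension (phi : K -> R) k a : continuous phi ->
  (forall p, phi (iota p) = (1 + d (fstMt p) (sndMt p))^-1) ->
  dbar k = a%:E -> phi k = (1 + a)^-1.
Proof.
move=> cphi phiE ka.
have a0 : 0 <= a by rewrite -lee_fin -ka dbar_ge0.
have cD : (fine \o dbar) x @[x --> k] --> a by apply: fine_cvg; rewrite -ka; exact: hdbar.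
have cH : phi x * (1 + (fine \o dbar) x) - 1 @[x --> k] --> phi k * (1 + a) - 1.
  apply: cvgB; last exact: cvg_cst.
  by apply: cvgM; [exact: cphi | apply: cvgD => //; exact: cvg_cst].
have a1 : 1 + a != 0 by rewrite gt_eqF//; lra.
have : phi k * (1 + a) - 1 = 0.
  apply/eqP; apply: contrapT => /negP ne.
  have [p /=] := stone_cech_dense hK (cvgr_neq0 _ cH ne).
  rewrite hdbarE phiE /= mulVf ?subrr ?eqxx// gt_eqF//.
  by have := d_ge0 (fstMt p) (sndMt p); lra.
by move=> /subr0_eq h; apply: (mulIf a1); rewrite h mulVf.
Qed.

(* A minimizer of [phi = 1 / (1 + d)] is carried by a sigma-compact set whose images under [p1] and
   [p2] are disjoint: [t / (1 + t)] is strictly subadditive, so junctions would be shortened. *)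
Lemma minimizer_push_singular (phi : K -> R) (A : set (Borel Ku)) :
  (exists x y z : M, [/\ x <> y, y <> z & x <> z]) ->
  continuous phi -> (forall p, phi (iota p) = (1 + d (fstMt p) (sndMt p))^-1) ->
  (forall e, 0 < e -> exists g, [/\ in_G d iota g, forall k, - phi k <= g k &
    \int[mu]_k (g k + phi k) <= e]) ->
  measurable A -> A `<=` RM d0bar ->
  mu [set k | dbar k = 0%E /\ A (p1 k)] = 0%E ->
  mu [set k | dbar k = +oo%E /\ (RM d0bar (p1 k) \/ RM d0bar (p2 k))] = 0%E ->
  restr_push_singular mu p1 p2 A.
Proof.
move=> hthree cphi phiE hmin mA ARM muN0 muNoo.
(* With the integrals below [t n * t n], Markov gives [T n] measure at most [t n], which is
   summable, so Borel-Cantelli applies. *)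
pose t (n : nat) : R := 1 / (2 ^ n.+1)%:R.
have t0 n : 0 < t n by rewrite divr_gt0// ltr0n expn_gt0.
have [g gP] : exists g : nat -> K -> R, forall n, [/\ in_G d iota (g n),
    forall k, - phi k <= g n k & \int[mu]_k (g n k + phi k) <= t n * t n].
  have /choice[g gP] : forall n, exists g, [/\ in_G d iota g, forall k, - phi k <= g k &
      \int[mu]_k (g k + phi k) <= t n * t n] by move=> n; apply: hmin; rewrite mulr_gt0.
  by exists g.
have cg n : continuous (g n) by case: (gP n) => -[].
have cgp n : continuous (fun k => g n k + phi k) by exact: continuous_add.
pose T n := [set k | t n < g n k + phi k].
have mT n : measurable (T n : set (Borel K)) by apply: open_Borel; exact: open_preimage_lt.
have muT n : (mu (T n) <= (t n)%:E)%E.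
  have [_ low le] := gP n.
  apply: (@markov_open R K cK mu (fun k => g n k + phi k) (t n) (t n) (T n)) => //.
  - by move=> k; have := low k; lra.
  - by move=> k /ltW.
have muL : mu (lim_sup_set T) = 0%E.
  apply: lim_sup_set_cvg0 => //.
  apply: (@le_lt_trans _ _ (\sum_(n <oo) (t n)%:E)%E).
    by apply: lee_nneseries => // n _ _; exact: measure_ge0.
  by apply: (le_lt_trans (@epsilon_trick0 R 1 xpredT ler01)); rewrite ltry.
have mL : measurable (lim_sup_set T : set (Borel K)).
  by apply: bigcap_measurable => // n _; exact: bigcup_measurable.
(* A rate valid from [N] on and explicit bounds on [dbar] make [F N] closed, so [p2] maps it to a
   compact, hence Borel, set. *)
pose F N := \bigcap_(n in [set n | (N <= n)%N]) [set k | g n k + phi k <= t n] `&`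
  ([set k | (N.+1%:R^-1%:E <= dbar k)%E] `&` [set k | (dbar k <= N%:R%:E)%E]).
have clF N : closed (F N).
  apply: closedI; first by apply: closed_bigI => n _; exact: closed_preimage_le.
  by apply: closedI; [exact: closed_preimage_gee | exact: closed_preimage_lee].
have clp2F N : closed (p2 @` F N).
  apply: compact_closed => //; apply: continuous_compact.
    exact: continuous_subspaceT.
  exact: (subclosed_compact (clF N) cK).
have F_dbar N k : F N k -> exists2 a, 0 < a & dbar k = a%:E.
  move=> [_ [/= lo hi]].
  have fk : dbar k \is a fin_num by rewrite ge0_fin_numE ?dbar_ge0// (le_lt_trans hi)// ltry.
  exists (fine (dbar k)); last by rewrite fineK.
  by move: lo; rewrite -{1}(fineK fk) lee_fin; apply: lt_le_trans; rewrite invr_gt0.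
have disj N1 N2 k1 k2 : F N1 k1 -> F N2 k2 -> p2 k1 <> p1 k2.
  move=> F1 F2 k12.
  have [a a0 ka] := F_dbar _ _ F1; have [b b0 kb] := F_dbar _ _ F2.
  (* [c] is the gap in the strict subadditivity; the index [n] below makes the total error
     [(a + b) * t n] smaller than it. *)
  pose c := a / (1 + a) + b / (1 + b) - (a + b) / (1 + (a + b)).
  have c0 : 0 < c.
    have -> : c = a * b * (2 + a + b) / ((1 + a) * (1 + b) * (1 + (a + b))).
      by rewrite /c; field; rewrite !gt_eqF//; lra.
    by rewrite divr_gt0// !mulr_gt0//; lra.
  pose n := maxn (maxn N1 N2) (Num.bound ((a + b) / c)).
  have [Gg low _] := gP n.
  have glow p : - (1 + d (fstMt p) (sndMt p))^-1 <= g n (iota p) by rewrite -phiE.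
  have := in_G_junction Gg hthree glow k12 ka kb.
  have h1 : g n k1 <= t n - (1 + a)^-1.
    rewrite -(inv1p_dist_extension cphi phiE ka) lerBrDr.
    by apply: F1.1; rewrite /= /n !leq_max leqnn.
  have h2 : g n k2 <= t n - (1 + b)^-1.
    rewrite -(inv1p_dist_extension cphi phiE kb) lerBrDr.
    by apply: F2.1; rewrite /= /n !leq_max leqnn orbT.
  have tn : (a + b) * t n < c.
    have ab : 0 <= (a + b) / c by rewrite ltW// divr_gt0// addr_gt0.
    rewrite /t mul1r ltr_pdivrMr ?ltr0n ?expn_gt0// mulrC -ltr_pdivrMr//.
    apply: (lt_trans (archi_boundP ab)); rewrite ltr_nat.
    apply: (@leq_ltn_trans n); first by rewrite /n leq_max leqnn orbT.
    by apply: ltn_trans (ltnSn n) _; exact: ltn_expl.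
  have := ler_wpM2l (ltW a0) h1; have := ler_wpM2l (ltW b0) h2.
  move: tn; rewrite /c !mulrBr; lra.
have exF k : ~ lim_sup_set T k -> dbar k <> 0%E -> dbar k <> +oo%E -> exists N, F N k.
  move=> nL dk0 dkoo.
  have [N HN] : exists N, forall n, (N <= n)%N -> g n k + phi k <= t n.
    apply: contrapT => H; apply: nL => N _; apply: contrapT => HN; apply: H.
    exists N => n Nn; rewrite leNgt; apply/negP => Tn; apply: HN; exists n => //.
  have fk : dbar k \is a fin_num.
    by rewrite ge0_fin_numE ?dbar_ge0// ltey; exact/eqP.
  have dpos : 0 < fine (dbar k).
    by rewrite fine_gt0// ltey lt_neqAle dbar_ge0 andbT eq_sym; apply/andP; split; exact/eqP.
  pose N' := maxn N (maxn (Num.bound (fine (dbar k))) (Num.bound (fine (dbar k))^-1)).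
  exists N'; split; last split.
  - by move=> n /= N'n; apply: HN; apply: leq_trans N'n; rewrite /N' leq_max leqnn.
  - rewrite /= -(fineK fk) lee_fin -[leRHS]invrK lef_pV2 ?posrE ?invr_gt0//.
    have i0 : 0 <= (fine (dbar k))^-1 by rewrite invr_ge0 ltW.
    apply: (le_trans (ltW (archi_boundP i0))); rewrite ler_nat.
    by apply: leq_trans (leqnSn _); rewrite /N' !leq_max leqnn !orbT.
  - rewrite /= -(fineK fk) lee_fin; apply: (le_trans (ltW (archi_boundP (ltW dpos)))).
    by rewrite ler_nat /N' !leq_max leqnn orbT.
pose B := \bigcup_N (p2 @` F N).
have mB : measurable (B : set (Borel Ku)).
  by apply: bigcup_measurable => N _; exact: closed_Borel.
pose Z0 := [set k | dbar k = 0%E /\ A (p1 k)].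
pose Zoo := [set k | dbar k = +oo%E /\ (RM d0bar (p1 k) \/ RM d0bar (p2 k))].
have mZ0 : measurable (Z0 : set (Borel K)).
  apply: measurableI; first by apply: closed_Borel; exact: closed_preimage_eqe.
  exact: (Borel_preimage hp1 mA).
have mZoo : measurable (Zoo : set (Borel K)).
  apply: measurableI; first by apply: closed_Borel; exact: closed_preimage_eqe.
  by apply: measurableU; apply: open_Borel; [exact: open_RM1 | exact: open_RM2].
have muZ : mu (lim_sup_set T `|` Z0 `|` Zoo) = 0%E.
  by rewrite measureU0 ?measureU0//; exact: measurableU.
have mZ : measurable (lim_sup_set T `|` Z0 `|` Zoo : set (Borel K)).
  by apply: measurableU => //; exact: measurableU.
(* Where [dbar] is 0 the projections agree, so [Z0], defined through [p1] alone, also handles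
   [A (p2 k)]. *)
have goodF k : A (p1 k) \/ A (p2 k) -> ~ (lim_sup_set T `|` Z0 `|` Zoo) k -> exists N, F N k.
  move=> Ak nZ; apply: exF.
  - by move=> L; apply: nZ; left; left.
  - move=> dk; apply: nZ; left; right; split => //.
    by case: Ak => //; rewrite (p1_eq_p2_of_dbar0 dk).
  - by move=> dk; apply: nZ; right; split => //; case: Ak => /ARM; [left | right].
have mAB : measurable (A `&` B : set (Borel Ku)) by exact: measurableI.
have mAB' : measurable (A `&` ~` B : set (Borel Ku)).
  by apply: measurableI => //; exact: measurableC.
exists B; split => //; split.
- apply: (subset_measure0 (Borel_preimage hp1 mAB) mZ _ muZ) => k [Ak [N1 _ [k1 F1 k1k]]].
  apply: contrapT => /(goodF _ (or_introl Ak))[N2 F2].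
  exact: (disj _ _ _ _ F1 F2).
- apply: (subset_measure0 (Borel_preimage hp2 mAB') mZ _ muZ) => k [Ak nB].
  apply: contrapT => /(goodF _ (or_intror Ak))[N FN].
  by apply: nB; exists N => //; exists k.
Qed.

End Transfer.

(** * The image under the adjoint and the total mass *)

Lemma in_G_Phi f F : is_Phi d iota f F -> in_G d iota F /\ in_G d iota (fun k => -1 * F k).
Proof.
have posd a b : a <> b -> d a b != 0.
  by move=> ab; rewrite gt_eqF//; exact: (dist_Mt_gt0 hd (exist _ (a, b) ab)).
(* [d * Phi f] is the difference [f x - f y], which telescopes: the inequality of G is an equality
   and holds for both signs. *)
have E x y (h : x <> y) c : d x y * (c * ((f x - f y) / d x y)) = c * (f x - f y).
  by rewrite mulrCA; congr (_ * _); rewrite mulrC divfK// posd.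
move=> [cF FE].
split; split => //.
- move=> x u y xu uy xy; rewrite !FE /fstMt /sndMt /=.
  have := E x y xy 1; have := E x u xu 1; have := E u y uy 1.
  by rewrite !mul1r => -> -> ->; lra.
- by apply: continuous_mul => //; exact: continuous_const.
- by move=> x u y xu uy xy; rewrite !FE /fstMt /sndMt /= !E//; lra.
Qed.

Section SameImage.
Variables mu nu : {measure set (Borel K) -> \bar R}.
Hypotheses (muoo : (mu setT < +oo)%E) (nuoo : (nu setT < +oo)%E) (munu : prec d iota mu nu).

Lemma prec_PhiStar_eq : PhiStar_eq d o iota mu nu.
Proof.
move=> f F _ fF; have [GF GNF] := in_G_Phi fF.
have cF : continuous F by case: GF.
have cNF : continuous (fun k => -1 * F k) by case: GNF.
have := munu GF; have := munu GNF.
rewrite !integral_RintegralE// !lee_fin !Rintegral_scale// !mulN1r lerN2 => h1 h2.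
by congr EFin; apply/eqP; rewrite eq_le h1 h2.
Qed.

Lemma prec_setT_le : (mu setT <= nu setT)%E.
Proof.
have := munu (in_G_const iota hd (@ler01 R)).
by rewrite !integral_cst// !mul1e.
Qed.

End SameImage.

Lemma PhiStar_norm_le (mu : {measure set (Borel K) -> \bar R}) : (mu setT < +oo)%E -> (PhiStar_norm d o iota mu <= mu setT)%E.
Proof.
move=> muoo; apply: ge_ereal_sup => _ [f [F [[_ fL] fF ->]]].
have [[cF _] _] := in_G_Phi fF.
have mf : mu setT \is a fin_num by rewrite ge0_fin_numE.
have F1 p : `|F (iota p)| <= 1.
  have dpos := dist_Mt_gt0 hd p.
  by rewrite fF.2 normrM normfV (gtr0_norm dpos) ler_pdivrMr// mul1r.
have Fle k : F k <= 1.
  apply: (@stone_cech_le _ _ _ _ _ hK F (fun=> 1)) => // [|p]; first exact: continuous_const.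
  by rewrite (le_trans (ler_norm _)).
have Fge k : -1 <= F k.
  apply: (@stone_cech_le _ _ _ _ _ hK (fun=> -1) F) => // [|p]; first exact: continuous_const.
  by have := F1 p; rewrite ler_norml => /andP[].
rewrite integral_RintegralE//= -(fineK mf) lee_fin ler_norml.
have c1 c : continuous (fun _ : K => c : R) by exact: continuous_const.
have h1 := Rintegral_mono cK muoo cF (c1 1) Fle.
have h2 := Rintegral_mono cK muoo (c1 (-1)) cF Fge.
by move: h1 h2; rewrite !Rintegral_const mul1r mulN1r => -> ->.
Qed.

End Compactifications.

Unset Implicit Arguments.
Set Strict Implicit.

Theorem theorem4p11 (R : realType) (M : Type) (d : M -> M -> R) (o : M)
  (hd : is_metric d) (hcomplete : complete_metric d)
  (hthree : exists x y z : M, [/\ x <> y, y <> z & x <> z])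
  (K : ptopologicalType) (iota : Mt M -> K) (hK : is_stone_cech d iota)
  (Ku : ptopologicalType) (iu : M -> Ku) (hKu : is_samuel d iu)
  (dbar : K -> \bar R) (hdbar : continuous dbar)
  (hdbarE : forall p : Mt M, dbar (iota p) = (d (fstMt p) (sndMt p))%:E)
  (p1 p2 : K -> Ku) (hp1 : continuous p1) (hp2 : continuous p2)
  (hp1E : forall p : Mt M, p1 (iota p) = iu (fstMt p))
  (hp2E : forall p : Mt M, p2 (iota p) = iu (sndMt p))
  (d0bar : Ku -> \bar R) (hd0bar : continuous d0bar)
  (hd0barE : forall x : M, d0bar (iu x) = (d x o)%:E)
  (nu : {measure set (Borel K) -> \bar R}) (hnu : radon nu)
  (hnorm : nu setT = PhiStar_norm d o iota nu) :
  exists mu : {measure set (Borel K) -> \bar R},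
    [/\ radon mu, mu setT = PhiStar_norm d o iota mu,
        PhiStar_eq d o iota mu nu,
        (forall C, frakC d iota C -> concentrated nu C -> concentrated mu C) &
        (forall A : set (Borel Ku), measurable A -> A `<=` RM d0bar ->
           concentrated nu (calR d0bar p1 p2 `\` Delta dbar p1 p2 A) ->
           restr_push_singular mu p1 p2 A)].
Proof.
have cK : compact [set: K] by case: hK.
have hsK : hausdorff_space K by case: hK.
have nuoo : (nu setT < +oo)%E by case: hnu.
have [phi [cphi phiE]] := exists_inv1p_dist hd hK.
have [mu [rmu munu hmin]] := exists_minimizer iota hd cK hsK nuoo cphi.
have muoo : (mu setT < +oo)%E by case: rmu.
have Phieq : PhiStar_eq d o iota mu nu by exact: prec_PhiStar_eq.
exists mu; split => //.
(* The chain closes up: the mass of [mu] is at most that of [nu], which is the norm of the common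
   image, which is at most the mass of [mu]. *)
- have normE : PhiStar_norm d o iota mu = PhiStar_norm d o iota nu.
    have lip f : lip0_ball d o f -> lip0 d o f.
      by move=> [fo fL]; split => //; exists 1 => x y; rewrite mul1r.
    congr ereal_sup; apply/seteqP; split => _ [f [F [fL fF ->]]]; exists f, F; split => //.
      by rewrite (Phieq f F)//; exact: lip.
    by rewrite (Phieq f F)//; exact: lip.
  apply/eqP; rewrite eq_le; apply/andP; split.
    by rewrite normE -hnorm; exact: (prec_setT_le hd munu).
  exact: (PhiStar_norm_le o hd hK muoo).
- by move=> C [_ HC] nuC; exact: (HC mu nu).
- move=> A mA ARM nuA.
  have oR := open_calR hp1 hp2 hd0bar.
  have mZ : measurable ([set k | dbar k = 0%E] : set (Borel K)).
    by apply: closed_Borel; exact: closed_preimage_eqe.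
  have m1 := Borel_preimage hp1 mA; have m2 := Borel_preimage hp2 mA.
  have mD : measurable (~` (calR d0bar p1 p2 `\` Delta dbar p1 p2 A) : set (Borel K)).
    apply: measurableC; apply: measurableD; first exact: open_Borel.
    by apply: measurableI => //; exact: measurableI.
  apply: (minimizer_push_singular hd hK hKu hdbar hdbarE hp1 hp2 hp1E hp2E hd0bar rmu
    hthree cphi phiE hmin mA ARM).
  (* Equality of the projections where [dbar] is 0 puts every such [k] with [A (p1 k)] into [Delta],
     which is null for [nu]. *)
  + apply: (mu_dbar0_null hd hK hKu hdbar hdbarE hp1 hp2 hp1E hp2E rmu hnu munu mA).
    have mN : measurable ([set k | dbar k = 0%E /\ A (p1 k)] : set (Borel K)).
      exact: measurableI.
    apply: (subset_measure0 mN mD _ nuA) => k [dk Ak] [_]; apply.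
    by split => //; split => //; rewrite -(p1_eq_p2_of_dbar0 hK hKu hdbar hdbarE hp1 hp2 hp1E hp2E dk).
  + apply: (mu_unbounded_null hd hK hdbar hdbarE hp1 hp2 hp1E hp2E hd0bar hd0barE rmu hnu munu).
    apply: (subset_measure0 _ mD _ nuA); first by apply: measurableC; exact: open_Borel.
    by move=> k nR [].
Qed.
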